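(* $\mathsf{MAR\text{-}XCAP} = \mathsf{XCAP}$.
   Context: An XCA (expanding cellular automaton) is a one-dimensional cellular automaton with state set $Q$, neighborhood $\{-1,0,1\}$, local rule $\delta\colon Q^3\to Q$, quiescent state $q$ and distinguished hidden state $\odot$, where $\delta(\ell)=\odot$ is allowed only if the middle entry of $\ell$ is $\odot$. Cells not in state $q$ (and visible) are active; active cells may not become quiescent. In each global step, every visible cell is updated by the usual CA rule, and between each pair of adjacent visible cells $c(z),c(z+1)$ a hidden cell takes state $\delta(c(z),\odot,c(z+1))$ and is inserted between them; afterwards all cells in state $\odot$ are deleted (contracting the configuration). The input $w$ is written on cells $0,\dots,|w|-1$, surrounded by quiescent cells. A standard XCA has a unique accept state $a$ and a unique reject state $r$; it halts and accepts (resp. rejects) in the first step in which all active cells are in state $a$ (resp. all in state $r$). $\mathsf{XCAP}$ is the class of languages accepted by XCAs that halt on every input within a number of steps polynomial in $|w|$. A multiple accept-reject XCA (MAR-XCA) instead has subsets $Q_{\mathrm{acc}},Q_{\mathrm{rej}}\subseteq Q$ of accept and reject states, accepts (resp. rejects) and halts in the first step in which all active cells have states in $Q_{\mathrm{acc}}$ (resp. $Q_{\mathrm{rej}}$), and must accept or reject every input after finitely many steps. $\mathsf{MAR\text{-}XCAP}$ is the class of languages decided by MAR-XCAs in polynomial time. *)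

(* Defs.v *)
From mathcomp Require Import all_boot.
Set Implicit Arguments. Unset Strict Implicit. Unset Printing Implicit Defensive.

Record xca_rule (Sigma : finType) := XcaRule {
  xQ : finType;
  delta : xQ -> xQ -> xQ -> xQ;
  quies : xQ;
  hid : xQ;
  inp : Sigma -> xQ;
  hid_neq_quies : hid != quies;
  inp_inj : injective inp;
  inp_active : forall s, inp s != quies;
  inp_visible : forall s, inp s != hid;
  delta_hid : forall a b c, delta a b c = hid -> b = hid;
  delta_active : forall a b c, b != quies -> b != hid -> delta a b c != quies;
  delta_qqq : delta quies quies quies = quies;
  delta_qhq : (delta quies hid quies == quies) || (delta quies hid quies == hid)
}.

Section Dynamics.
Variables (Sigma : finType) (X : xca_rule Sigma).

(* A configuration is represented by a finite window [w] of visible cells,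
   meaning ... q q w q q ... (quiescent cells outside). One global step:
   update every visible cell (including the two quiescent neighbours of the
   window), insert hidden cells between adjacent visible cells, then delete
   all cells in the hidden state. *)
Definition xstep (w : seq (xQ X)) : seq (xQ X) :=
  let p := nth (quies X) [:: quies X, quies X & w ++ [:: quies X; quies X]] in
  let v j := delta (p j.-1) (p j) (p j.+1) in
  let h j := delta (p j) (hid X) (p j.+1) in
  filter (predC1 (hid X))
    (v 1 :: flatten [seq [:: h j; v j.+1] | j <- iota 1 (size w).+1]).

Definition xconf (u : seq Sigma) (t : nat) : seq (xQ X) :=
  iter t xstep (map (@inp _ X) u).

Definition all_active_in (A : {set xQ X}) (c : seq (xQ X)) : bool :=
  all (fun x => (x == quies X) || (x \in A)) c.

Definition halts_at (Qacc Qrej : {set xQ X}) (u : seq Sigma) (t : nat) :=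
  (all_active_in Qacc (xconf u t) || all_active_in Qrej (xconf u t)) /\
  forall t', t' < t ->
    ~~ all_active_in Qacc (xconf u t') /\ ~~ all_active_in Qrej (xconf u t').

Definition decides_poly (Qacc Qrej : {set xQ X}) (L : pred (seq Sigma)) :=
  exists k c : nat, forall u : seq Sigma, u != [::] ->
    exists t, [/\ halts_at Qacc Qrej u t, t <= c * (size u).+1 ^ k &
      if L u then all_active_in Qacc (xconf u t) && ~~ all_active_in Qrej (xconf u t)
      else all_active_in Qrej (xconf u t) && ~~ all_active_in Qacc (xconf u t)].

End Dynamics.

Definition XCAP (Sigma : finType) (L : pred (seq Sigma)) : Prop :=
  exists (X : xca_rule Sigma) (a r : xQ X),
    a != r /\ @decides_poly _ X [set a] [set r] L.

Definition MAR_XCAP (Sigma : finType) (L : pred (seq Sigma)) : Prop :=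
  exists (X : xca_rule Sigma) (Qacc Qrej : {set xQ X}),
    @decides_poly _ X Qacc Qrej L.

(* Main.v *)
From HB Require Import structures.
Require Import Defs.
From mathcomp Require Import all_boot zify ring.
Set Implicit Arguments. Unset Strict Implicit. Unset Printing Implicit Defensive.

(** Being in [Qacc] everywhere at time [t] is a condition on exponentially many
cells, and a cell showing the single state [a] has forgotten everything else.
The simulating automaton [Y] therefore works with blocks of polynomial length,
each of which carries the whole input and recomputes one cell of the simulated
automaton from scratch.

For [t = 0, 1, 2, ...] there is an accept phase and a reject phase.  In the phase
for [t], a block starts from the padded input and keeps a window of the
configuration; by duplicating itself, one copy dropping the first cell of its
window, it first reaches every starting position, and then, after each simulated
step, both the old cells and the newly born ones.  As the window is cut to the
length of the block, at most three of its cells become unreliable per step, and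
four paddings per [t] are enough.  After [t] steps the cells of the configuration
at time [t] are exactly the first cells of the windows (up to quiescent ones).

A block whose cell is good for the current phase turns into cells that alternate
between [a] and [r] for ever; a block whose cell is bad goes on to the next phase,
which loses nothing, because it still has the input.  All blocks run in lockstep,
so that [Y] shows only [a] (in an accept phase) or only [r] (in a reject phase)
exactly when all blocks are good.  Within a block, everything is done by one head
that sweeps over all the cells, which makes the timing independent of the
contents. *)

(** * Windows of a configuration *)

Section Windows.
Variables (Sigma : finType) (X : xca_rule Sigma).
Local Notation Q := (xQ X).
Local Notation q := (quies X).

Definition born (y x : Q) : option Q :=
  let h := delta y (hid X) x in if h == hid X then None else Some h.

(* One step, seen from a window [z] with only quiescent cells on its right and an
unknown left neighbour, so that the first cell of [z] is not updated. *)
Fixpoint expand (z : seq Q) : seq Q :=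
  if z is y :: z' then
    seq_of_opt (born y (nth q z' 0)) ++
      delta y (nth q z' 0) (nth q z' 1) :: expand z'
  else [::].

Lemma delta_visible (a b c : Q) : b != hid X -> delta a b c != hid X.
Proof. by apply: contraNneq => /delta_hid ->. Qed.

Lemma xstep_visible (w : seq Q) : hid X \notin xstep w.
Proof. by rewrite /xstep mem_filter /= eqxx. Qed.

Lemma xconf_visible u t : hid X \notin xconf X u t.
Proof.
case: t => [|t]; last exact: xstep_visible.
by apply/mapP => -[s _ /esym/eqP]; rewrite (negPf (inp_visible X s)).
Qed.

(** Only newborn cells can be hidden, since [delta] keeps a visible middle cell visible; so the
    deletion in [xstep] is the [None] case of [born]. The tape [p] is abstract so that the induction
    can advance its origin [k]. *)
Lemma expand_visible_filter (p : nat -> Q) k z :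
    (forall i, p (k + i) = nth q z i) -> hid X \notin z ->
  filter (predC1 (hid X))
    (flatten [seq [:: delta (p j) (hid X) (p j.+1); delta (p j) (p j.+1) (p j.+2)]
             | j <- iota k (size z)]) = expand z.
Proof.
elim: z k => [|y z IHz] k //= pE; rewrite inE => /norP[_ hz].
rewrite (IHz k.+1) //; last by move=> i; rewrite addSnnS pE.
have p1 : p k.+1 = nth q z 0 by rewrite -addn1 pE.
have p2 : p k.+2 = nth q z 1 by rewrite -addn2 pE.
have p0 : p k = y by rewrite -[k in LHS]addn0 pE.
have vis : delta y (nth q z 0) (nth q z 1) != hid X.
  apply: delta_visible; case: z hz {pE IHz p1 p2} => [|x z] /=.
    by rewrite eq_sym (hid_neq_quies X).
  by rewrite inE eq_sym => /norP[].
by rewrite p0 p1 p2 vis /born; case: eqP.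
Qed.

Lemma xstep_expand (c : seq Q) : hid X \notin c ->
  xstep c = delta q q (nth q c 0) :: expand (q :: c).
Proof.
move=> hc; rewrite /xstep; set p := nth q _.
have pS i : p i.+2 = nth q c i.
  by rewrite /p /= nth_cat; case: ltnP => // le; rewrite (nth_default q le);
     case: (i - size c) => [|[|[]]].
have p1 : p 1 = q by []. have p0 : p 0 = q by [].
rewrite [in X in _ = X](_ : delta q q (nth q c 0) = delta (p 0) (p 1) (p 2)); last first.
  by rewrite pS.
rewrite -(@expand_visible_filter p 1 (q :: c)); last 2 first.
- by case=> [|i] //; rewrite add1n pS.
- by rewrite inE negb_or hc (hid_neq_quies X).
by rewrite /= delta_visible //= eq_sym (hid_neq_quies X).
Qed.

Lemma born_qq : exists b, seq_of_opt (born q q) = nseq b q.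
Proof.
rewrite /born; case/orP: (delta_qhq X) => /eqP ->; last by rewrite eqxx; exists 0.
by rewrite eq_sym (negPf (hid_neq_quies X)); exists 1.
Qed.

(** Two paddings are used up: the leftmost one is not updated, and the one next to [c] becomes the
    first cell of [xstep c]. Births between quiescent cells can only add paddings. *)
Lemma expand_pad i (c : seq Q) : hid X \notin c ->
  exists2 k, i <= k & expand (nseq i.+2 q ++ c) = nseq k q ++ xstep c.
Proof.
move=> hc; have [b bE] := born_qq; elim: i => [|i [k ik IHk]].
  by exists b => //; rewrite /= bE xstep_expand.
exists (b + k.+1); first by rewrite ltn_addl.
have -> : expand (nseq i.+3 q ++ c) =
  seq_of_opt (born q q) ++ delta q q q :: expand (nseq i.+2 q ++ c) by [].
by rewrite IHk bE delta_qqq nseqD -catA.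
Qed.

Lemma iter_expand_pad s P (u : seq Sigma) : 2 * s <= P ->
  exists k, [/\ P <= k + 2 * s &
    iter s expand (nseq P q ++ map (@inp _ X) u) = nseq k q ++ xconf X u s].
Proof.
elim: s => [|s IHs] sP; first by exists P; rewrite muln0 addn0.
have [|k [Pk IHk]] := IHs; first by lia.
have [i kE] : exists i, k = i.+2 by exists (k - 2); lia.
have [k' ik' E] := expand_pad i (xconf_visible u s).
by exists k'; split; [lia | rewrite iterS IHk kE E].
Qed.

(** * Windows that agree on a prefix *)

Definition agree m (A Z : seq Q) := forall i, i < m -> nth q A i = nth q Z i.

Lemma agree_trans m A B C : agree m A B -> agree m B C -> agree m A C.
Proof. by move=> AB BC i im; rewrite AB ?BC. Qed.

Lemma agree_sym m A B : agree m A B -> agree m B A.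
Proof. by move=> AB i im; rewrite AB. Qed.

(** The second window produces cells and the first does not, but those cells are quiescent, which is
    also the default. Thus [expand_agree] may assume nonempty windows. *)
Lemma expand_nil m : agree m (expand [::]) (expand [:: q]).
Proof.
move=> i _; have [b bE] := born_qq.
by rewrite nth_nil /= bE delta_qqq nth_cat nth_nseq nth_seq1 !if_same.
Qed.

(** The new cell at index [i] depends on old cells up to index [i + 2] at most; the worst case is
    that no cell is born before it. *)
Lemma expand_agree m A Z : agree m.+2 A Z -> agree m (expand A) (expand Z).
Proof.
elim: m A Z => [|m IHm] A Z AZ; first by case.
have nilq i : nth q [:: q] i = nth q [::] i by rewrite nth_seq1 nth_nil if_same.
wlog [[y [A1 AE]] [y' [Z1 ZE]]] :
    A Z AZ / (exists y A1, A = y :: A1) /\ (exists y Z1, Z = y :: Z1).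
  move=> H; pose cns (B : seq Q) := if B is [::] then [:: q] else B.
  have cnsE k B : agree k (expand B) (expand (cns B)).
    by case: B => [|? ?] //; apply: expand_nil.
  apply: agree_trans (cnsE _ A) _; apply: agree_trans (agree_sym (cnsE _ Z)).
  apply: H; last by split; [case: (A) | case: (Z)] => /=; eauto.
  by move=> i /AZ; case: (A) (Z) => [|? ?] [|? ?] /=; rewrite ?nilq.
move: AZ; rewrite {}AE {}ZE => {A Z} AZ.
have hd1 i : i < m.+2 -> nth q A1 i = nth q Z1 i by move=> im; have /= -> := AZ i.+1 im.
have <- : y = y' by exact: (AZ 0).
rewrite /= -!hd1 //; case: (born _ _) => [h|] [|[|i]] //= im; last 2 first.
- exact: IHm hd1 _ _.
- exact: (IHm _ _ hd1 i.+1).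
exact: (IHm _ _ hd1 i (ltnW _)).
Qed.

Lemma expand_drop d Z : exists d', expand (drop d Z) = drop d' (expand Z).
Proof.
elim: d Z => [|d IHd] Z; first by exists 0; rewrite !drop0.
case: Z => [|y Z] /=; first by exists 0.
have [d' ->] := IHd Z.
exists (d' + size (rcons (seq_of_opt (born y (nth q Z 0))) (delta y (nth q Z 0) (nth q Z 1)))).
by rewrite -drop_drop -cat_rcons drop_size_cat.
Qed.

Lemma iter_expand_drop t d Z :
  exists d', iter t expand (drop d Z) = drop d' (iter t expand Z).
Proof.
elim: t => [|t [d' IH]] /=; first by exists d.
by rewrite IH; apply: expand_drop.
Qed.

(** A nonempty suffix of the new window starts at a newborn cell or at an updated one. Both come
    from the same old suffix, up to one removed first cell; hence one fork per simulated step is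
    enough. *)
Lemma drop_expand d' Z : d' < size (expand Z) -> exists2 d, d < size Z &
  drop d' (expand Z) = expand (drop d Z) \/
  drop d' (expand Z) = behead (expand (drop d Z)).
Proof.
elim: Z d' => [|y Z IHZ] d' //=; set s := seq_of_opt _; set v := delta _ _ _.
rewrite size_cat /= => lt; case: (leqP d' (size s)) => d's.
  exists 0 => //; rewrite drop0 /= -/s -/v; case: d' d's {lt} => [|d']; first by rewrite drop0; left.
  by rewrite /s; case: born => [h|] //=; case: d' => // _; right; rewrite drop0.
have [d dZ E] := IHZ (d' - (size s).+1) ltac:(lia).
exists d.+1 => //=; rewrite -cat_rcons drop_cat size_rcons ltnNge d's /=; exact: E.
Qed.

Definition popq (A : seq Q) := rcons (behead A) q.

Lemma nth_popq A i : nth q (popq A) i = nth q A i.+1.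
Proof.
rewrite nth_rcons nth_behead size_behead; case: ltnP => //= le.
by rewrite [RHS]nth_default ?if_same //; lia.
Qed.

Lemma size_popq A : 0 < size A -> size (popq A) = size A.
Proof. by case: A => //= a A _; rewrite size_rcons. Qed.

(** * The tree of windows reached by forking *)

Fixpoint forks n (A : seq Q) : seq (seq Q) :=
  if n is n'.+1 then forks n' A ++ forks n' (popq A) else [:: A].

Lemma forks_sound n A A' : A' \in forks n A ->
  exists d, forall i, nth q A' i = nth q A (d + i).
Proof.
elim: n A => [|n IHn] A; first by rewrite inE => /eqP ->; exists 0.
rewrite /= mem_cat => /orP[/IHn //|/IHn[d E]].
by exists d.+1 => i; rewrite E nth_popq.
Qed.

Lemma forks_complete n d A : d <= n -> exists2 A', A' \in forks n A &
  forall i, nth q A' i = nth q A (d + i).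
Proof.
elim: n d A => [|n IHn] d A; first by rewrite leqn0 => /eqP ->; exists A; rewrite ?inE.
case: d => [|d] dn /=.
  by have [A' A'n E] := IHn 0 A isT; exists A' => //; rewrite mem_cat A'n.
have [A' A'n E] := IHn d (popq A) dn.
by exists A'; [rewrite mem_cat A'n orbT | move=> i; rewrite E nth_popq].
Qed.

Definition wstep (A : seq Q) := take (size A) (expand A).

Fixpoint walk t (A : seq Q) : seq (seq Q) :=
  if t is t'.+1 then walk t' (wstep A) ++ walk t' (popq (wstep A)) else [:: A].

Lemma size_expand A : size A <= size (expand A).
Proof. by elim: A => //= y A IHA; rewrite size_cat /= addnS ltnS (leq_trans IHA) ?leq_addl. Qed.

Lemma size_wstep A : size (wstep A) = size A.
Proof. by rewrite size_takel ?size_expand. Qed.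

Lemma wstep_agree m A Z : m <= size A -> agree m.+2 A Z -> agree m (wstep A) (expand Z).
Proof.
move=> mA /expand_agree AZ i im.
by rewrite nth_take ?(leq_trans im) // AZ.
Qed.

Lemma popq_agree m A Z : agree m.+1 A Z -> agree m (popq A) (behead Z).
Proof. by move=> AZ i im; rewrite nth_popq nth_behead AZ. Qed.

(** Per step, two reliable cells are lost to [wstep] and one more to [popq]. The last reliable one
    is the first cell of the window, the only one that is inspected. *)
Lemma walk_sound t A A' Z : 3 * t <= size A -> agree (3 * t).+1 A Z ->
  A' \in walk t A -> exists d, agree 1 A' (drop d (iter t expand Z)).
Proof.
elim: t A Z => [|t IHt] A Z tA AZ /=.
  by rewrite inE => /eqP ->; exists 0; rewrite drop0.
have A1 : agree (3 * t).+2 (wstep A) (expand Z).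
  by apply: wstep_agree; [lia | move=> i ?; apply: AZ; lia].
rewrite mem_cat -iterS iterSr => /orP[] /IHt.
  by apply; [rewrite size_wstep; lia | move=> i ?; apply: A1; lia].
case/(_ _ _ (popq_agree A1)) => [|d]; first by rewrite size_popq ?size_wstep; lia.
rewrite -drop1; have [d' ->] := iter_expand_drop t 1 (expand Z).
by rewrite drop_drop; exists (d + d').
Qed.

(** [F] describes the available windows. The induction replaces it by the windows reached after one
    step, with or without the pop, and [drop_expand] shows that these again cover every suffix. *)
Lemma walk_complete t Z x (F : seq Q -> Prop) :
    (forall d, d < size Z -> exists A,
       [/\ F A, 3 * t <= size A & agree (3 * t).+1 A (drop d Z)]) ->
    x \in iter t expand Z ->
  exists A A', [/\ F A, A' \in walk t A & nth q A' 0 = x].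
Proof.
elim: t Z F => [|t IHt] Z F FZ.
  move=> /(nthP q)[d dZ <-]; have [A [FA _ /(_ 0 isT)]] := FZ d dZ.
  by rewrite nth_drop addn0 => E; exists A, A; rewrite inE.
rewrite iterSr => xZ.
pose F' B := exists2 A, F A & B = wstep A \/ B = popq (wstep A).
have [|A' [A'' [[A FA A'E] A''W <-]]] := IHt _ F' _ xZ; last first.
  exists A, A''; split=> //=; rewrite mem_cat.
  by case: A'E A''W => -> ->; rewrite ?orbT.
move=> d' /drop_expand[d /FZ[A [FA sA AZ]] E].
have A1 : agree (3 * t).+2 (wstep A) (expand (drop d Z)).
  by apply: wstep_agree; [lia | move=> i ?; apply: AZ; lia].
case: E => ->; last first.
  exists (popq (wstep A)); split; first by exists A; auto.
    by rewrite size_popq ?size_wstep; lia.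
  exact: popq_agree.
exists (wstep A); split; first by exists A; auto.
  by rewrite size_wstep; lia.
by move=> i ?; apply: A1; lia.
Qed.

Definition leaves t (A : seq Q) := flatten [seq walk t A' | A' <- forks (size A) A].

Lemma size_forks n A : 0 < size A -> {in forks n A, forall A', size A' = size A}.
Proof.
elim: n A => [|n IHn] A A0 A'; first by rewrite inE => /eqP ->.
by rewrite /= mem_cat => /orP[] /IHn ->; rewrite ?size_popq.
Qed.

(** This turns the global halting condition into a test on single windows. Windows that start in the
    paddings or beyond the right end show a quiescent cell and pass trivially. *)
Lemma all_leaves (S : {set Q}) t P (u : seq Sigma) :
    0 < size u -> 3 * t <= P ->
  all (fun A => (nth q A 0 == q) || (nth q A 0 \in S))
    (leaves t (nseq P q ++ map (@inp _ X) u)) = all_active_in S (xconf X u t).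
Proof.
move=> u0 tP; set Z := _ ++ _.
have [|k [_ ZE]] := @iter_expand_pad t P u; first by lia.
have sZ : size Z = P + size u by rewrite size_cat size_nseq size_map.
transitivity (all_active_in S (iter t expand Z)); last first.
  rewrite ZE /all_active_in all_cat; case: (all _ (xconf _ _ _)); rewrite ?andbF ?andbT //.
  by apply/allP => x /nseqP[->]; rewrite eqxx.
apply/allP/allP => [allL x | allZ A' /flatten_mapP[A AZ A'A]]; last first.
  have [d AE] := forks_sound AZ.
  have sA : size A = size Z by apply: size_forks AZ; rewrite sZ; lia.
  have [||d' E] := @walk_sound t A A' (drop d Z) _ _ A'A; first by rewrite sA sZ; lia.
    by move=> i _; rewrite AE nth_drop.
  have [d'' E''] := iter_expand_drop t d Z.
  rewrite E // E'' drop_drop nth_drop addn0.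
  case: (ltnP (d' + d'') (size (iter t expand Z))) => lt; last by rewrite nth_default ?eqxx.
  by apply: allZ; apply: mem_nth.
move=> xZ.
have [|A [A' [AZ A'A <-]]] := @walk_complete t Z x (fun A => A \in forks (size Z) Z) _ xZ.
  move=> d /ltnW /(forks_complete Z)[A AZ AE]; exists A; split=> //.
    by rewrite (size_forks _ AZ) ?sZ; lia.
  by move=> i _; rewrite AE nth_drop.
by apply: allL; apply/flatten_mapP; exists A.
Qed.

End Windows.

(** * The simulating automaton *)

Section Machine.
Variables (Sigma : finType) (X : xca_rule Sigma) (Qacc Qrej : {set xQ X}).
Local Notation Q := (xQ X).
Local Notation q := (quies X).

(* Input symbols and paddings; each [inl true] stands for one step to simulate. *)
Definition usym := (bool + Sigma)%type.

(* Tracks [U], [A], [B], [C]: [U] is the padded input; the others are stacks with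
their tops at the left end of the block.  [A] is the window, [B] a scratch copy or
the counter of the initial forks, [C] a copy of [U] popped to count the steps. *)
Definition data := (usym * option Q * option Q * option usym)%type.

(* The second component is the copy that is shifted out of the block by a fork. *)
Definition cont := (option data * option data)%type.

(* States of a head on its way to the right; see [turnL] for the control flow.  The
options and the symbol of [Rgrow] are the items in transit.  The boolean of the
fork modes is the one expected by [ret]. *)
Inductive rmode :=
| Rinit  (* load [A], [B] and [C] *)
| RtoB   (* next initial fork *)
| RtoC   (* next simulated step *)
| Rchk   (* inspect the top of [A] *)
| Rlose  (* turn the block into alternating cells *)
| Rcopy of bool | Rshift of bool & option data | Rsplit of bool (* fork *)
| Rrev of option Q (* move [A] to [B], which reverses it *)
(* Move [B] back to [A], replacing it by its [expand]: [Rold] pushes the updated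
   cell, [Rborn] the cell born on its left; [Rold y x] and [Rborn y x] remember
   the last two cells read. *)
| Rold of Q & Q & option Q | Rborn of Q & Q & option Q
| Rgrow of bool & usym. (* push a padding on [U] *)

(** A sum of known finite types, from which [rmode] inherits its finiteness; the other inductive
    types are treated likewise. *)
Definition rcode : Type :=
  ('I_5 + bool + (bool * option data) + bool + option Q + (Q * Q * option Q)
   + (Q * Q * option Q) + (bool * usym))%type.

Definition rmode_code (k : rmode) : rcode :=
  match k with
  | Rinit => inl (inl (inl (inl (inl (inl (inl (@Ordinal 5 0 isT)))))))
  | RtoB => inl (inl (inl (inl (inl (inl (inl (@Ordinal 5 1 isT)))))))
  | RtoC => inl (inl (inl (inl (inl (inl (inl (@Ordinal 5 2 isT)))))))
  | Rchk => inl (inl (inl (inl (inl (inl (inl (@Ordinal 5 3 isT)))))))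
  | Rlose => inl (inl (inl (inl (inl (inl (inl (@Ordinal 5 4 isT)))))))
  | Rcopy b => inl (inl (inl (inl (inl (inl (inr b))))))
  | Rshift b d => inl (inl (inl (inl (inl (inr (b, d))))))
  | Rsplit b => inl (inl (inl (inl (inr b))))
  | Rrev c => inl (inl (inl (inr c)))
  | Rold y x c => inl (inl (inr (y, x, c)))
  | Rborn y x c => inl (inr (y, x, c))
  | Rgrow b u => inr (b, u)
  end.

Definition rmode_decode (k : rcode) : rmode :=
  match k with
  | inl (inl (inl (inl (inl (inl (inl i)))))) =>
      nth Rinit [:: Rinit; RtoB; RtoC; Rchk; Rlose] i
  | inl (inl (inl (inl (inl (inl (inr b)))))) => Rcopy b
  | inl (inl (inl (inl (inl (inr (b, d)))))) => Rshift b d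
  | inl (inl (inl (inl (inr b)))) => Rsplit b
  | inl (inl (inl (inr c))) => Rrev c
  | inl (inl (inr (y, x, c))) => Rold y x c
  | inl (inr (y, x, c)) => Rborn y x c
  | inr (b, u) => Rgrow b u
  end.

Lemma rmode_codeK : cancel rmode_code rmode_decode.
Proof. by case. Qed.

HB.instance Definition _ := Finite.copy rmode (can_type rmode_codeK).

(* On the way to the left, [LpopK] pops [A] for [Rchk], [LpopF] for a fork, [LpopT]
for [Rrev], and [LpopS] pops [B] for [Rborn]. *)
Inductive lmode :=
| LpopB of option Q | LpopC of option usym | LpopK of option Q
| LpopF of bool & option Q | LpopT of option Q | LpopS of Q & Q & option Q
| Lboth of bool & bool | Lgo of rmode | Lgrow | Lflip.

Definition lcode : Type :=
  (option Q + option usym + option Q + (bool * option Q) + option Q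
   + (Q * Q * option Q) + (bool * bool) + rmode + bool)%type.

Definition lmode_code (k : lmode) : lcode :=
  match k with
  | LpopB c => inl (inl (inl (inl (inl (inl (inl (inl c)))))))
  | LpopC c => inl (inl (inl (inl (inl (inl (inl (inr c)))))))
  | LpopK c => inl (inl (inl (inl (inl (inl (inr c))))))
  | LpopF b c => inl (inl (inl (inl (inl (inr (b, c))))))
  | LpopT c => inl (inl (inl (inl (inr c))))
  | LpopS y x c => inl (inl (inl (inr (y, x, c))))
  | Lboth b f => inl (inl (inr (b, f)))
  | Lgo k => inl (inr k)
  | Lgrow => inr true
  | Lflip => inr false
  end.

Definition lmode_decode (k : lcode) : lmode :=
  match k with
  | inl (inl (inl (inl (inl (inl (inl (inl c))))))) => LpopB c
  | inl (inl (inl (inl (inl (inl (inl (inr c))))))) => LpopC c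
  | inl (inl (inl (inl (inl (inl (inr c)))))) => LpopK c
  | inl (inl (inl (inl (inl (inr (b, c)))))) => LpopF b c
  | inl (inl (inl (inl (inr c)))) => LpopT c
  | inl (inl (inl (inr (y, x, c)))) => LpopS y x c
  | inl (inl (inr (b, f))) => Lboth b f
  | inl (inr k) => Lgo k
  | inr true => Lgrow
  | inr false => Lflip
  end.

Lemma lmode_codeK : cancel lmode_code lmode_decode.
Proof. by case. Qed.

HB.instance Definition _ := Finite.copy lmode (can_type lmode_codeK).

(* [HS] moves to the left at half speed. *)
Inductive hmode := HR of rmode | HL of lmode | HS of bool & rmode.

Definition hmode_code (k : hmode) : rmode + lmode + bool * rmode :=
  match k with
  | HR k => inl (inl k) | HL k => inl (inr k) | HS b k => inr (b, k)
  end.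

Definition hmode_decode (k : rmode + lmode + bool * rmode) : hmode :=
  match k with
  | inl (inl k) => HR k | inl (inr k) => HL k | inr (b, k) => HS b k
  end.

Lemma hmode_codeK : cancel hmode_code hmode_decode.
Proof. by case. Qed.

HB.instance Definition _ := Finite.copy hmode (can_type hmode_codeK).

(* Kind of the phase ([true] for accept), state of the alternating cells at the
current time ([true] for [Ya]), mode. *)
Definition head_state := (bool * bool * hmode)%type.

(* The booleans of [Ycell] mark the first and the last cell of a block. *)
Inductive ystate :=
| Yq | Yhid | Ya | Yr | Yin of Sigma
| Ycell of bool & bool & option head_state & cont.

Definition ycode : Type :=
  ('I_4 + Sigma + (bool * bool * option head_state * cont))%type.

Definition ystate_code (x : ystate) : ycode :=
  match x with
  | Yq => inl (inl (@Ordinal 4 0 isT)) | Yhid => inl (inl (@Ordinal 4 1 isT))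
  | Ya => inl (inl (@Ordinal 4 2 isT)) | Yr => inl (inl (@Ordinal 4 3 isT))
  | Yin s => inl (inr s) | Ycell f e h g => inr (f, e, h, g)
  end.

Definition ystate_decode (x : ycode) : ystate :=
  match x with
  | inl (inl i) => nth Yq [:: Yq; Yhid; Ya; Yr] i
  | inl (inr s) => Yin s
  | inr (f, e, h, g) => Ycell f e h g
  end.

Lemma ystate_codeK : cancel ystate_code ystate_decode.
Proof. by case. Qed.

HB.instance Definition _ := Finite.copy ystate (can_type ystate_codeK).

(** * The local rule *)

Definition usym_val (s : usym) : Q := if s is inr x then inp X x else q.

Definition ret b := if b then RtoC else RtoB.

(** Exchanging the item in transit with the entry of each cell shifts a track to the right, which is
    a push at the left end. Once [None] is in transit, the push is complete. *)
Definition fr_data (k : rmode) (d : data) : rmode * data :=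
  let: (u, a, b, c) := d in
  match k with
  | Rinit => (k, (u, Some (usym_val u), Some q, Some u))
  | Rrev (Some v) => (Rrev b, (u, a, Some v, c))
  | Rold y x (Some v) => (Rold y x a, (u, Some v, b, c))
  | Rborn y x (Some v) => (Rborn y x a, (u, Some v, b, c))
  | Rgrow i v => (Rgrow i u, (v, a, b, c))
  | _ => (k, d)
  end.

(** The second component holds the copy: [Rcopy] creates it, [Rshift] moves it by one cell, and
    [Rsplit] makes it the data of the right half. *)
Definition fr (k : rmode) (g : cont) : rmode * cont :=
  match k with
  | Rcopy _ => (k, (g.1, g.1))
  | Rshift b c => (Rshift b g.2, (g.1, c))
  | Rsplit _ => (k, if g.1 is Some _ then g else (g.2, None))
  | _ => if g.1 is Some d then
           let: (k', d') := fr_data k d in (k', (Some d', g.2))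
         else (k, g)
  end.

Definition fl_data (k : lmode) (d : data) : lmode * data :=
  let: (u, a, b, c) := d in
  match k with
  | LpopB v => (LpopB b, (u, a, v, c))
  | LpopS y x v => (LpopS y x b, (u, a, v, c))
  | LpopC v => (LpopC c, (u, a, b, v))
  | LpopK v => (LpopK a, (u, v, b, c))
  | LpopF i v => (LpopF i a, (u, v, b, c))
  | LpopT v => (LpopT a, (u, v, b, c))
  | _ => (k, d)
  end.

(** [Lboth] finds out whether original and copy still overlap in some cell. *)
Definition fl (k : lmode) (g : cont) : lmode * cont :=
  match k with
  | Lboth b i => (Lboth b (i || isSome g.1 && isSome g.2), g)
  | _ => if g.1 is Some d then
           let: (k', d') := fl_data k d in (k', (Some d', g.2))
         else (k, g)
  end.

(** The optional content is that of a cell to be appended at the right end of the block. *)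
Definition turnR (k : rmode) : lmode * option cont :=
  match k with
  | Rinit | RtoB => (LpopB None, None)
  | RtoC => (LpopC None, None)
  | Rchk => (LpopK None, None)
  | Rcopy b => (Lboth b false, None)
  | Rshift b c => (Lboth b false, Some (None, c))
  | Rsplit b => (LpopF b (Some q), None)
  | Rrev _ => (LpopT None, None)
  | Rold y x _ => (Lgo (Rborn y x (born y x)), None)
  | Rborn y x _ => (LpopS y x None, None)
  | Rgrow i v => (if i then Lgrow else Lflip, Some (Some (v, None, None, None), None))
  | Rlose => (Lflip, None)
  end.

Definition good acc (v : option Q) :=
  if v is Some x then (x == q) || (x \in if acc then Qacc else Qrej) else true.

Definition turnL acc (k : lmode) : bool * rmode :=
  match k with
  | LpopB v => (acc, if v is Some _ then Rcopy false else RtoC)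
  | LpopC v => (acc, match v with
                     | Some (inl true) => Rrev None
                     | Some (inl false) => RtoC
                     | _ => Rchk
                     end)
  | LpopK v => (acc, if good acc v then Rlose else Rgrow true (inl false))
  | LpopF b _ => (acc, ret b)
  | LpopT v => (acc, if v is Some _ then Rrev v else Rborn q q None)
  | LpopS y x v => (acc, if v is Some w then Rold w y (Some (delta w y x)) else Rcopy true)
  | Lboth b i => (acc, if i then Rshift b None else Rsplit b)
  | Lgo k => (acc, k)
  | Lgrow => (acc, Rgrow false (inl (~~ acc)))
  | Lflip => (~~ acc, Rinit)
  end.

Definition lost (p : bool) := if p then Ya else Yr.

Definition boundary (k : rmode) (g g' : cont) :=
  if k is Rsplit _ then isSome g.1 && ~~ isSome g'.1 else false.

(* When a block splits, the head of the right half still has to go right and back,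
and the slow head given to the left half takes exactly as long. *)
Definition act_right (r : ystate) f e acc p (k : rmode) (g : cont) : ystate :=
  if ~~ e && (if r is Ycell _ _ _ g' then boundary k g g' else false) then
    Ycell f true (Some (acc, ~~ p, HS false (if k is Rsplit b then ret b else k))) g
  else let: (k', g') := fr k g in
    if e then
      let: (l, o) := turnR k' in
      if o is Some _ then Ycell f false None g'
      else Ycell f true (Some (acc, ~~ p, HL l)) g'
    else Ycell f e None g'.

(* In mode [Rlose] the last cell waits until the alternating cells are about to
show the answer of the phase. *)
Definition act (r : ystate) f e (h : head_state) (g : cont) : ystate :=
  let: (acc, p, k) := h in
  match k with
  | HR k =>
      if k is Rlose then
        if e && (p == acc) then Ycell f e (Some (acc, ~~ p, HR Rlose)) g
        else lost (~~ p)
      else act_right r f e acc p k g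
  | HL k =>
      let: (k', g') := fl k g in
      if f then let: (acc', k'') := turnL acc k' in
        Ycell f e (Some (acc', ~~ p, HR k'')) g'
      else Ycell f e None g'
  | HS tick k =>
      Ycell f e (if tick then if f then Some (acc, ~~ p, HR k) else None
                 else Some (acc, ~~ p, HS true k)) g
  end.

Definition fromL (l : ystate) (g : cont) : option (bool * head_state) :=
  if l is Ycell _ false (Some (acc, p, HR k)) g' then
    Some (boundary k g' g, (acc, ~~ p, HR (fr k g').1))
  else None.

Definition fromR (r : ystate) : option head_state :=
  match r with
  | Ycell false _ (Some (acc, p, HL k)) g => Some (acc, ~~ p, HL (fl k g).1)
  | Ycell false _ (Some (acc, p, HS true k)) g => Some (acc, ~~ p, HS false k)
  | _ => None
  end.

Definition birth (l : ystate) : option ystate :=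
  if l is Ycell _ true (Some (acc, p, HR k)) g then
    let: (k', o) := turnR (fr k g).1 in
    omap (fun g' => Ycell false true (Some (acc, ~~ p, HL k')) g') o
  else None.

Definition is_quiet (x : ystate) := if x is Yq then true else false.

(** In the first step the input cells become one block, whose ends are recognised by their quiescent
    neighbours. *)
Definition ydelta (l x r : ystate) : ystate :=
  match x with
  | Yq => Yq
  | Yhid => odflt Yhid (birth l)
  | Ya => Yr
  | Yr => Ya
  | Yin s => Ycell (is_quiet l) (is_quiet r)
               (if is_quiet l then Some (true, true, HR Rinit) else None)
               (Some (inr s, None, None, None), None)
  | Ycell f e (Some h) g => act r f e h g
  | Ycell f e None g =>
      if fromL l g is Some (sp, h) then Ycell (f || sp) e (Some h) g
      else if fromR r is Some h then Ycell f e (Some h) g else x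
  end.

Definition cell_or_lost f (x : ystate) :=
  match x with Ycell f' _ _ _ => f' == f | Ya | Yr => true | _ => false end.

(** A coarse description of the results of [act], strong enough for [ydelta_hid], [ydelta_active]
    and the preservation of [closedL]. *)
Fact act_cell r f e h g : cell_or_lost f (act r f e h g).
Proof.
case: h => [[acc p] [k|k|tick k]] /=; last by rewrite eqxx.
  have H : cell_or_lost f (act_right r f e acc p k g).
    rewrite /act_right; case: ifP => [_|_ /=]; first by rewrite /= eqxx.
    case: (fr k g) => k' g'; case: e; rewrite /= ?eqxx //.
    by case: (turnR k') => l []; rewrite /= ?eqxx.
  case: k H => [||||_|?|? ?|?|?|? ? ?|? ? ?|? ?] //.
  by case: ifP; rewrite /= ?eqxx //; case: p.
by case: (fl k g) => k' g'; case: f => //; case: (turnL acc k').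
Qed.

Fact ydelta_hid a b c : ydelta a b c = Yhid -> b = Yhid.
Proof.
case: b => //= f e [h|] g; last first.
  by case: fromL => [[]|] //; case: fromR.
by move=> E; have := act_cell c f e h g; rewrite E.
Qed.

Fact ydelta_active a b c : b != Yq -> b != Yhid -> ydelta a b c != Yq.
Proof.
move=> bq bh; apply/eqP; case: b bq bh => //= f e [h|] g _ _; last first.
  by case: fromL => [[]|] //; case: fromR.
by move=> E; have := act_cell c f e h g; rewrite E.
Qed.

Fact Yin_inj : injective Yin.
Proof. by move=> x y []. Qed.

Definition Y : xca_rule Sigma :=
  @XcaRule Sigma ystate ydelta Yq Yhid Yin isT Yin_inj (fun _ => isT) (fun _ => isT)
    ydelta_hid ydelta_active erefl isT.

(* A step of [Y] between quiescent cells; [l] is the left neighbour of [w]. *)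
Fixpoint go (l : ystate) (w : seq ystate) : seq ystate :=
  if w is x :: w' then
    ydelta l x (head Yq w') :: seq_of_opt (birth x) ++ go x w'
  else [::].

Lemma born_birth (y x : xQ Y) : born y x = birth y.
Proof.
rewrite /born /=; case: y => //= f [] // [[[acc p] [k|k|tick k]]|] g //.
by case: (turnR _) => l [].
Qed.

Lemma expand_go (l : xQ Y) w :
  expand (l :: w) = seq_of_opt (birth l) ++ rcons (go l w) Yq.
Proof.
elim: w l => [|x w IHw] l; first by rewrite /= born_birth.
have -> : expand (l :: x :: w) =
  seq_of_opt (born l x) ++ ydelta l x (nth Yq w 0) :: expand (x :: w) by [].
by rewrite IHw born_birth /= rcons_cat nth0.
Qed.

Lemma go_quiet i w : go Yq (nseq i Yq ++ w) = nseq i Yq ++ go Yq w.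
Proof. by elim: i => //= i ->. Qed.

Lemma go_quietr l w i : go l (w ++ nseq i Yq) = go l w ++ nseq i Yq.
Proof.
elim: w l => [|x w IHw] l /=; last by rewrite IHw catA; case: w {IHw} => //; case: i.
by elim: i l => //= i IHi l; rewrite IHi.
Qed.

(** Quiescent cells never change, even next to active ones, so the margins of the window just grow
    by one cell on each side. *)
Lemma xconf_go (u : seq Sigma) t :
  xconf Y u t = nseq t Yq ++ iter t (go Yq) (map Yin u) ++ nseq t Yq.
Proof.
elim: t => [|t IHt]; first by rewrite cats0.
have -> : xconf Y u t.+1 = xstep (xconf Y u t) by [].
rewrite xstep_expand ?xconf_visible // IHt expand_go /= -cats1.
rewrite go_quiet go_quietr -!catA.
have <- // : nseq t Yq ++ [:: Yq] = Yq :: nseq t Yq.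
by rewrite -[[:: Yq]]/(nseq 1 Yq) -nseqD addn1.
Qed.

(** * Independence of the blocks *)

(** Where a cell with [closedR] is followed by one with [closedL], neither influences the other.
    Such a place is a border between blocks or stretches of alternating cells. *)
Definition closedL (x : ystate) :=
  match x with Ya | Yr | Ycell true _ _ _ => true | _ => false end.
Definition closedR (x : ystate) :=
  match x with Ya | Yr | Ycell _ true _ _ => true | _ => false end.
Definition closed (s : seq ystate) := closedL (head Yq s) && closedR (last Yq s).

Lemma closed_neq0 s : closed s -> s <> [::].
Proof. by case: s. Qed.

Lemma act_closedR r r' f h g : act r f true h g = act r' f true h g.
Proof. by case: h => [[acc p] [k|k|tick k]]. Qed.

Lemma ydelta_closedR l x r : closedR x -> closedL r -> ydelta l x r = ydelta l x Yq.
Proof.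
case: x => //= f [] // [h|] g _ rL; first exact: act_closedR.
by case: fromL => // ; case: r rL => //= -[].
Qed.

Lemma ydelta_closedL l x r : closedR l -> closedL x -> ydelta l x r = ydelta Yq x r.
Proof. by case: x => //= -[] // e [h|] g lR _ //; case: l lR => //= f [] // [[[]]|]. Qed.

Lemma go_closedL l w : closedR l -> closedL (head Yq w) -> go l w = go Yq w.
Proof. by case: w => //= x w lR xL; rewrite (ydelta_closedL _ lR). Qed.

Lemma go_cat l s1 s2 : closedR (last l s1) -> closedL (head Yq s2) ->
  s1 <> [::] -> go l (s1 ++ s2) = go l s1 ++ go Yq s2.
Proof.
elim: s1 l => [|x s1 IHs] l //= xR sL _; case: s1 IHs xR => [_ /=|y s1 IHs xR].
  by move=> xR; rewrite (ydelta_closedR _ xR sL) (go_closedL xR sL) cats0.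
by rewrite [go x (_ ++ _)]IHs // -catA.
Qed.

Lemma head_cat_ne (s1 s2 : seq ystate) : s1 <> [::] -> head Yq (s1 ++ s2) = head Yq s1.
Proof. by case: s1. Qed.

Lemma closed_cat s1 s2 : closed s1 -> closed s2 -> closed (s1 ++ s2).
Proof.
move=> c1 c2; have := closed_neq0 c1; have := closed_neq0 c2.
move: c1 c2 => /andP[h1 _] /andP[_ l2] n2 n1.
by rewrite /closed head_cat_ne // h1 last_cat; case: s2 l2 n2.
Qed.

Lemma go_cat_closed s1 s2 : closed s1 -> closed s2 ->
  go Yq (s1 ++ s2) = go Yq s1 ++ go Yq s2.
Proof.
move=> c1 /andP[h2 _]; rewrite go_cat //; last exact: closed_neq0.
by case/andP: c1.
Qed.

Lemma ydelta_keepL l x r : closedL x -> closedL (ydelta l x r).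
Proof.
case: x => //= -[] // e [h|] g _.
  by have := act_cell r true e h g; case: act => // -[].
by case: fromL => [[]|] //; case: fromR.
Qed.

Lemma birth_closedR x y : birth x = Some y -> closedR y.
Proof.
case: x => //= f [] // [[[acc p] []]|] // k g.
by case: turnR => l [g'|] //= [<-].
Qed.

(** A last cell that gives birth hands its end mark over to the newborn; that case is covered by
    [birth_closedR]. *)
Lemma ydelta_keepR l x r : closedR x -> birth x = None -> closedR (ydelta l x r).
Proof.
case: x => //= f [] // [[[acc p] [k|k|tick k]]|] g _ //=; last 2 first.
- by case: (fl k g) => k' g' _; case: f => //; case: (turnL acc k').
- by case: fromL => [[]|] //; case: fromR.
have H : omap (fun g' => Ycell false true (Some (acc, ~~ p, HL (turnR (fr k g).1).1)) g')
      (turnR (fr k g).1).2 = None -> closedR (act_right r f true acc p k g).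
  by rewrite /act_right /=; case: (fr k g) => k' g' /=; case: (turnR k') => l' [].
case: k H => [||||_|?|? ?|?|?|? ? ?|? ? ?|? ?] H; last first.
all: try by move=> E; apply: H; move: E; case: turnR.
by case: ifP => // _; case: (p).
Qed.

Lemma go_keepR l w : closedR (last Yq w) -> closedR (last Yq (go l w)).
Proof.
elim: w l => [|x w IHw] l //=; case: w IHw => [_ xR|y w IHw /(IHw x)].
  rewrite /= cats0; case E: (birth x) => [y|] /=; first exact: birth_closedR E.
  exact: ydelta_keepR.
by rewrite !last_cat; case: (go x _) => //.
Qed.

Lemma closed_go s : closed s -> closed (go Yq s).
Proof.
move=> /andP[hs ls]; rewrite /closed go_keepR // andbT.
by case: s hs {ls} => //= x s; apply: ydelta_keepL.
Qed.

Lemma closed_iter t s : closed s -> closed (iter t (go Yq) s).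
Proof. by move=> cs; elim: t => //= t; apply: closed_go. Qed.

Lemma iter_go_cat t s1 s2 : closed s1 -> closed s2 ->
  iter t (go Yq) (s1 ++ s2) = iter t (go Yq) s1 ++ iter t (go Yq) s2.
Proof.
move=> c1 c2; elim: t => //= t ->.
by rewrite go_cat_closed ?closed_iter.
Qed.

Lemma closed_flatten ss : all closed ss -> ss <> [::] -> closed (flatten ss).
Proof.
elim: ss => [|s ss IHss] //= /andP[cs css] _; case: ss IHss css => [|s' ss IHss css].
  by rewrite cats0.
by apply: closed_cat => //; apply: IHss.
Qed.

(** Reduces the analysis of a configuration to single blocks. *)
Lemma iter_go_flatten t (ss : seq (seq ystate)) : all closed ss ->
  iter t (go Yq) (flatten ss) = flatten (map (iter t (go Yq)) ss).
Proof.
elim: ss => [_|s ss IHss /= /andP[cs css]]; first by elim: t => //= t ->.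
case: ss IHss css => [_ _|s' ss IHss css]; first by rewrite /= !cats0.
by rewrite iter_go_cat ?IHss //; apply: closed_flatten.
Qed.

(** * Movements of the head *)

Arguments act : simpl never.

Definition bare (g : cont) : option head_state * cont := (None, g).

Fixpoint lay (f e : bool) (s : seq (option head_state * cont)) : seq ystate :=
  if s is x :: s' then Ycell f (e && nilp s') x.1 x.2 :: lay false e s' else [::].

Definition noR (l : ystate) :=
  if l is Ycell _ false (Some (_, _, HR _)) _ then false else true.

Lemma noR_fromL l g : noR l -> fromL l g = None.
Proof. by case: l => // f [] // [[[? ?] []]|]. Qed.

Lemma lay_cat f e s1 x s2 :
  lay f e (s1 ++ x :: s2) = lay f false s1 ++ lay (f && nilp s1) e (x :: s2).
Proof.
elim: s1 f => [|y s1 IHs] f; first by rewrite andbT.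
by rewrite /= IHs (_ : nilp (s1 ++ _) = false) ?andbF //; case: (s1).
Qed.

Lemma go_idle l f e c t : noR l -> fromR (head Yq t) = None ->
  go l (lay f e (map bare c) ++ t) =
  lay f e (map bare c) ++ go (last l (lay f e (map bare c))) t.
Proof.
elim: c l f => [|g c IHc] l f lR tL //=.
rewrite noR_fromL // IHc //=; last by case: (e && _).
by case: c {IHc} => [|g' c] /=; rewrite ?tL if_same.
Qed.

Lemma noR_idle l f e c : noR l -> noR (last l (lay f e (map bare c))).
Proof. by elim: c l f => //= g c IHc l f _; apply: IHc; case: (e && _). Qed.

Lemma go_idle_end l f e c : noR l -> go l (lay f e (map bare c)) = lay f e (map bare c).
Proof. by move=> lR; have := @go_idle l f e c [::] lR erefl; rewrite !cats0. Qed.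

Definition at_head c1 h x c2 := lay true true (map bare c1 ++ (Some h, x) :: map bare c2).

Lemma at_headE c1 h x c2 : at_head c1 h x c2 =
  lay true false (map bare c1) ++
  Ycell (nilp c1) (nilp c2) (Some h) x :: lay false true (map bare c2).
Proof. by rewrite /at_head lay_cat /=; case: c1; case: c2. Qed.

Lemma last_lay y f s : s <> [::] -> closedR (last y (lay f true s)).
Proof.
elim: s y f => // x s IHs y f _ /=; case: s IHs => // x' s IHs.
exact: (IHs (Ycell _ _ _ _)).
Qed.

Lemma closed_lay s : s <> [::] -> closed (lay true true s).
Proof. by move=> s0; rewrite /closed last_lay //; case: s s0. Qed.

(** All that matters about the left neighbour [l] is that no head arrives from it, so it stays
    unspecified. *)
Lemma go_at_head c1 h x c2 : (c1 <> [::] -> fromR (Ycell false (nilp c2) (Some h) x) = None) ->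
  exists l, noR l /\ go Yq (at_head c1 h x c2) =
  lay true false (map bare c1) ++
    go l (Ycell (nilp c1) (nilp c2) (Some h) x :: lay false true (map bare c2)).
Proof.
move=> hx; rewrite at_headE; case: c1 hx => [|g c1] hx.
  by exists Yq.
rewrite go_idle ?hx //; eexists; split; last reflexivity.
exact: noR_idle.
Qed.

Lemma act_HR r f e acc p k g : k <> Rlose -> act r f e (acc, p, HR k) g = act_right r f e acc p k g.
Proof. by case: k. Qed.

Lemma R_move c1 acc p k x y c2 : k <> Rlose -> ~~ boundary k x y ->
  go Yq (at_head c1 (acc, p, HR k) x (y :: c2)) =
  at_head (rcons c1 (fr k x).2) (acc, ~~ p, HR (fr k x).1) y c2.
Proof.
move=> kl kb.
have [l [lR ->]] := @go_at_head c1 (acc, p, HR k) x (y :: c2) (fun _ => erefl).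
rewrite at_headE map_rcons -cats1 lay_cat /= -catA; congr cat.
rewrite act_HR // /act_right /= (negPf kb) go_idle_end; last by case: nilp.
by case: (fr k x) => k' x' /=; case: c1 => [|? ?]; case: c2.
Qed.

Lemma go_cons l x w : go l (x :: w) = ydelta l x (head Yq w) :: seq_of_opt (birth x) ++ go x w.
Proof. by []. Qed.

Lemma ydelta_bare l f e g r : noR l -> ydelta l (Ycell f e None g) r = Ycell f e (fromR r) g.
Proof. by move=> lR; rewrite /= noR_fromL //; case: fromR. Qed.

Lemma R_turn c1 acc p k x l : k <> Rlose -> turnR (fr k x).1 = (l, None) ->
  go Yq (at_head c1 (acc, p, HR k) x [::]) = at_head c1 (acc, ~~ p, HL l) (fr k x).2 [::].
Proof.
move=> kl kE.
have [l0 [lR ->]] := @go_at_head c1 (acc, p, HR k) x [::] (fun _ => erefl).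
rewrite at_headE; congr cat; rewrite /= act_HR // /act_right /= kE /=.
by case: (fr k x) kE => k' x' /= ->.
Qed.

Lemma R_turn_ext c1 acc p k x l g : k <> Rlose -> turnR (fr k x).1 = (l, Some g) ->
  go Yq (at_head c1 (acc, p, HR k) x [::]) =
  at_head (rcons c1 (fr k x).2) (acc, ~~ p, HL l) g [::].
Proof.
move=> kl kE.
have [l0 [lR ->]] := @go_at_head c1 (acc, p, HR k) x [::] (fun _ => erefl).
rewrite at_headE map_rcons -cats1 lay_cat /= -catA; congr cat.
rewrite act_HR // /act_right /= kE /=.
by case: (fr k x) kE => k' x' /= ->; case: c1.
Qed.

Lemma at_head_rcons c1 y h x c2 : at_head (rcons c1 y) h x c2 =
  lay true false (map bare c1) ++
    [:: Ycell (nilp c1) false None y, Ycell false (nilp c2) (Some h) x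
      & lay false true (map bare c2)].
Proof. by rewrite at_headE map_rcons -cats1 lay_cat /= -catA; case: c1. Qed.

Lemma go_at_head_rcons c1 y h h' x c2 :
    noR (Ycell false (nilp c2) (Some h) x) ->
    fromR (Ycell false (nilp c2) (Some h) x) = Some h' ->
    birth (Ycell false (nilp c2) (Some h) x) = None ->
  go Yq (at_head (rcons c1 y) h x c2) =
  lay true false (map bare c1) ++
    [:: Ycell (nilp c1) false (Some h') y,
        ydelta (Ycell (nilp c1) false None y) (Ycell false (nilp c2) (Some h) x)
          (head Yq (lay false true (map bare c2)))
      & lay false true (map bare c2)].
Proof.
move=> hR hL hB; rewrite at_head_rcons go_idle //; last by case: (c1).
congr cat.
have lR : noR (last Yq (lay true false (map bare c1))) by apply: noR_idle.
rewrite !go_cons ydelta_bare // [fromR _]hL hB /= go_idle_end //.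
Qed.

Lemma L_move c1 y acc p k x c2 :
  go Yq (at_head (rcons c1 y) (acc, p, HL k) x c2) =
  at_head c1 (acc, ~~ p, HL (fl k x).1) y ((fl k x).2 :: c2).
Proof.
rewrite (@go_at_head_rcons _ _ _ (acc, ~~ p, HL (fl k x).1)) //; last 2 first.
- by case: nilp.
- by rewrite /=; case: nilp.
rewrite at_headE; congr cat; rewrite /= /act; case: (fl k x) => k' x' /=.
by case: c2.
Qed.

Lemma S_move c1 y acc p k x c2 :
  go Yq (at_head (rcons c1 y) (acc, p, HS true k) x c2) =
  at_head c1 (acc, ~~ p, HS false k) y (x :: c2).
Proof.
rewrite (@go_at_head_rcons _ _ _ (acc, ~~ p, HS false k)) //; last 2 first.
- by case: nilp.
- by rewrite /=; case: nilp.
by rewrite at_headE; congr cat; case: c2.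
Qed.

Lemma go_at_head0 h x c2 : noR (Ycell true (nilp c2) (Some h) x) ->
    birth (Ycell true (nilp c2) (Some h) x) = None ->
  go Yq (at_head [::] h x c2) =
  act (head Yq (lay false true (map bare c2))) true (nilp c2) h x ::
    lay false true (map bare c2).
Proof.
move=> hR hB; by rewrite at_headE [_ ++ _]/= go_cons hB /= go_idle_end.
Qed.

Lemma L_turn acc p k x c2 : go Yq (at_head [::] (acc, p, HL k) x c2) =
  at_head [::] ((turnL acc (fl k x).1).1, ~~ p, HR (turnL acc (fl k x).1).2) (fl k x).2 c2.
Proof.
rewrite go_at_head0; last 2 first.
- by case: nilp.
- by rewrite /=; case: nilp.
rewrite at_headE /act; case: (fl k x) => k' x' /=.
by case: (turnL acc k') => acc' k''; case: c2.
Qed.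

Lemma S_turn acc p k x c2 : go Yq (at_head [::] (acc, p, HS true k) x c2) =
  at_head [::] (acc, ~~ p, HR k) x c2.
Proof.
rewrite go_at_head0; last 2 first.
- by case: nilp.
- by rewrite /=; case: nilp.
by rewrite at_headE /act; case: c2.
Qed.

Lemma S_wait c1 acc p k x c2 : go Yq (at_head c1 (acc, p, HS false k) x c2) =
  at_head c1 (acc, ~~ p, HS true k) x c2.
Proof.
have [l0 [lR ->]] := @go_at_head c1 (acc, p, HS false k) x c2 (fun _ => erefl).
rewrite at_headE; congr cat; rewrite [go _ _]/= go_idle_end; last by case: (c2).
by congr cons; case: (c2).
Qed.

Lemma R_split c1 acc p b x y c2 : isSome x.1 -> ~~ isSome y.1 ->
  go Yq (at_head c1 (acc, p, HR (Rsplit b)) x (y :: c2)) =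
  at_head c1 (acc, ~~ p, HS false (ret b)) x [::] ++
  at_head [::] (acc, ~~ p, HR (Rsplit b)) y c2.
Proof.
move=> x1 y1.
have [l [lR ->]] := @go_at_head c1 (acc, p, HR (Rsplit b)) x (y :: c2) (fun _ => erefl).
rewrite !at_headE -catA; congr cat; rewrite [go _ _]/=.
rewrite go_idle_end; last by case: nilp.
by rewrite /act /act_right /= x1 y1 /=; case: c2.
Qed.

Arguments at_head : simpl never.
Arguments go : simpl never.

(** * Complete sweeps over a block *)

Fixpoint rsw (k : rmode) (c : seq cont) : rmode * seq cont :=
  if c is g :: c' then
    ((rsw (fr k g).1 c').1, (fr k g).2 :: (rsw (fr k g).1 c').2)
  else (k, [::]).

Fixpoint lsw (k : lmode) (c : seq cont) : lmode * seq cont :=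
  if c is g :: c' then
    ((fl (lsw k c').1 g).1, (fl (lsw k c').1 g).2 :: (lsw k c').2)
  else (k, [::]).

Lemma lsw_rcons k c x :
  lsw k (rcons c x) = ((lsw (fl k x).1 c).1, rcons (lsw (fl k x).1 c).2 (fl k x).2).
Proof. by elim: c => [|g c /= ->]. Qed.

Lemma rsw_rcons k c x :
  rsw k (rcons c x) = ((fr (rsw k c).1 x).1, rcons (rsw k c).2 (fr (rsw k c).1 x).2).
Proof. by elim: c k => [|g c IHc] k //=; rewrite IHc. Qed.

Lemma size_rsw k c : size (rsw k c).2 = size c.
Proof. by elim: c k => //= g c IHc k; rewrite IHc. Qed.

Lemma fr_not_lose k g : k <> Rlose -> (fr k g).1 <> Rlose.
Proof.
case: g => [[[[[u a] b] c]|] s]; case: k => [||||//|?|? ?|?|c'|? ? c'|? ? c'|? ?] //= _;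
by case: c'.
Qed.

Definition is_split (k : rmode) := if k is Rsplit _ then true else false.

Lemma is_split_fr k g : is_split (fr k g).1 = is_split k.
Proof.
case: g => [[[[[u a] b] c]|] s]; case: k => [|||||?|? ?|?|c'|? ? c'|? ? c'|? ?] //=;
by case: c'.
Qed.

Lemma rsw_not_lose k c : k <> Rlose -> (rsw k c).1 <> Rlose.
Proof. by elim: c k => //= g c IHc k kl; apply: IHc; apply: fr_not_lose. Qed.

(** Ensures that a splitting head does not meet the cut during the sweep: the cells all have, or all
    lack, a first component. *)
Definition uniform (k : rmode) (c : seq cont) :=
  is_split k ==> constant [seq isSome g.1 | g <- c].

Lemma uniform_boundary k x y c : uniform k (x :: y :: c) -> ~~ boundary k x y.
Proof.
rewrite /uniform; case: k => //= b; rewrite /= => /andP[/eqP -> _].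
by case: (isSome _).
Qed.

Lemma uniform_fr k x y c : uniform k (x :: y :: c) -> uniform (fr k x).1 (y :: c).
Proof.
rewrite /uniform is_split_fr; case: is_split => //= /andP[/eqP yx].
by rewrite yx.
Qed.

Definition run c1 h (c : seq cont) := if c is x :: s then at_head c1 h x s else [::].

Lemma R_to c1 acc p k s z rest : k <> Rlose -> uniform k (rcons s z) ->
  iter (size s) (go Yq) (run c1 (acc, p, HR k) (s ++ z :: rest)) =
  at_head (c1 ++ (rsw k s).2) (acc, odd (size s) (+) p, HR (rsw k s).1) z rest.
Proof.
elim: s c1 p k => [|x s IHs] c1 p k kl ku; first by rewrite cats0.
have [y [s' E]] : exists y s', s ++ z :: rest = y :: s'.
  by case: s {IHs ku} => [|? ?] /=; eauto.
have ku' : ~~ boundary k x y /\ uniform (fr k x).1 (rcons s z).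
  have : exists s'', rcons s z = y :: s''.
    by case: s E {IHs ku} => [|? ?] /= [-> _]; eauto.
  by case=> s'' E''; move: ku; rewrite /= E'' => ku; split;
     [apply: uniform_boundary ku | apply: uniform_fr ku].
rewrite [size _]/= iterSr /= E /= R_move //; last by case: ku'.
have := IHs (rcons c1 (fr k x).2) (~~ p) (fr k x).1 (fr_not_lose kl) (proj2 ku').
by rewrite E /= => ->; rewrite cat_rcons addNb addbN.
Qed.

Definition blk acc p k (c : seq cont) := run [::] (acc, p, HR k) c.

Lemma L_sweep c1 acc p k x c2 :
  let kc := lsw k (rcons c1 x) in
  iter (size c1).+1 (go Yq) (at_head c1 (acc, p, HL k) x c2) =
  blk (turnL acc kc.1).1 (odd (size c1).+1 (+) p) (turnL acc kc.1).2 (kc.2 ++ c2).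
Proof.
elim/last_ind: c1 p k x c2 => [|c1 y IHc] p k x c2.
  by rewrite /= L_turn.
rewrite size_rcons iterSr L_move IHc !lsw_rcons /= !cat_rcons.
by rewrite !addNb addbN.
Qed.

(** The slow head spends one step waiting and one step moving in each cell. *)
Lemma S_sweep c1 acc p k x c2 :
  iter (2 * (size c1).+1) (go Yq) (at_head c1 (acc, p, HS false k) x c2) =
  blk acc p k (c1 ++ x :: c2).
Proof.
elim/last_ind: c1 p x c2 => [|c1 y IHc] p x c2.
  by rewrite muln1 /= S_wait S_turn negbK.
rewrite size_rcons mulnS [2 + _]addnC iterD [iter 2 _ _]/= S_wait S_move IHc negbK.
by rewrite cat_rcons.
Qed.

(** The duration depends only on lengths: one step per cell on the way right, and one per cell of
    the possibly extended block on the way back. The parity keeps track of what alternating cells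
    show. *)
Lemma round acc p k c l o :
  let c' := (rsw k c).2 ++ seq_of_opt o in
  let kc := lsw l c' in
    k <> Rlose -> uniform k c -> c <> [::] -> turnR (rsw k c).1 = (l, o) ->
  iter (size c + size c') (go Yq) (blk acc p k c) =
  blk (turnL acc kc.1).1 (odd (size c + size c') (+) p) (turnL acc kc.1).2 kc.2.
Proof.
move=> c' kc kl ku c0 tE.
have [s [z cE]] : exists s z, c = rcons s z.
  by case/lastP: (c) c0 => // s z _; exists s, z.
have sc : size c = (size s).+1 by rewrite cE size_rcons.
have := @R_to [::] acc p k s z [::] kl; rewrite -cE cats1 -cE => /(_ ku) {}E.
have tE' : turnR (fr (rsw k s).1 z).1 = (l, o) by rewrite -tE cE rsw_rcons.
have c'E : c' = rcons (rsw k s).2 (fr (rsw k s).1 z).2 ++ seq_of_opt o.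
  by rewrite /c' cE rsw_rcons.
have kl' := rsw_not_lose (c := s) kl.
rewrite addnC iterD sc iterS {2}/blk E; case: o @c' @kc {tE} tE' c'E => [g|] c' kc tE' c'E.
  rewrite (R_turn_ext _ _ _ _ tE') //.
  have -> : size c' = (size (rcons (rsw k s).2 (fr (rsw k s).1 z).2)).+1.
    by rewrite c'E size_cat addn1.
  rewrite L_sweep cats0 /kc c'E cats1; congr blk.
  by rewrite oddD addbC !oddS; do 2 case: (odd _); case: (p).
rewrite (R_turn _ _ _ kl' tE').
have -> : size c' = (size (rsw k s).2).+1 by rewrite c'E size_cat addn0 size_rcons.
rewrite L_sweep cats0 /kc c'E cats0; congr blk.
by rewrite oddD addbC !oddS; do 2 case: (odd _); case: (p).
Qed.

Lemma round_eq acc p k c k1 c1 l o l1 c2 acc' k2 :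
    k <> Rlose -> uniform k c -> c <> [::] -> rsw k c = (k1, c1) -> turnR k1 = (l, o) ->
    lsw l (c1 ++ seq_of_opt o) = (l1, c2) -> turnL acc l1 = (acc', k2) ->
  iter (2 * size c + isSome o) (go Yq) (blk acc p k c) =
  blk acc' (isSome o (+) p) k2 c2.
Proof.
move=> kl ku c0 rE tE lE tlE.
have sc : size c1 = size c by rewrite -(size_rsw k c) rE.
have := @round acc p k c l o kl ku c0; rewrite rE => /(_ tE); rewrite lE /= tlE /=.
have -> : size c + size (c1 ++ seq_of_opt o) = 2 * size c + isSome o.
  by rewrite size_cat sc; case: (o) => /=; lia.
by rewrite oddD oddM /= oddb.
Qed.

(** * Duplication of a block *)

Definition plain (d : data) : cont := (Some d, None).
Definition shadow (d : data) : cont := (None, Some d).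

Lemma rsw_map (T : Type) (i j : T -> cont) k c :
  (forall x, fr k (i x) = (k, j x)) -> rsw k (map i c) = (k, map j c).
Proof. by move=> ij; elim: c => //= x c IHc; rewrite ij IHc. Qed.

Lemma lsw_map (T : Type) (i j : T -> cont) k c :
  (forall x, fl k (i x) = (k, j x)) -> lsw k (map i c) = (k, map j c).
Proof. by move=> ij; elim: c => //= x c ->; rewrite ij. Qed.

Lemma lsw_both b i c :
  lsw (Lboth b i) c = (Lboth b (i || has (fun g => isSome g.1 && isSome g.2) c), c).
Proof. by elim: c => [|g c /= ->] /=; rewrite ?orbF // -orbA [_ || (_ && _)]orbC. Qed.

Lemma lsw_popF b o c : exists o', (lsw (LpopF b o) (map plain c)).1 = LpopF b o'.
Proof.
elim: c => [|[[[u a] b'] c'] c [o' IHc]] /=; first by exists o.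
by rewrite IHc; exists a.
Qed.

Lemma closed_at_head c1 h x c2 : closed (at_head c1 h x c2).
Proof. by apply: closed_lay; case: c1. Qed.

Lemma constant_map (T : Type) (i : T -> bool) (v : bool) (s : seq T) :
  (forall x, i x = v) -> constant (map i s).
Proof.
by move=> iv; case: s => //= x s; rewrite iv; elim: s => //= y s ->; rewrite iv eqxx.
Qed.

Lemma rsw_shift i o (a b : seq (option data)) : size a = size b ->
  rsw (Rshift i o) (zip a b) = (Rshift i (last o b), zip a (belast o b)).
Proof. by elim: a b o => [|x a IHa] [|y b] o //= [/IHa ->]. Qed.

(** Each shift is a round over [l + i] cells that appends one cell, hence the odd summands. *)
Fixpoint shift_time l i j :=
  if j is j'.+1 then shift_time l i.+1 j' + (2 * (l + i)).+1 else 0.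

Definition fork_time l := 3 * l + (shift_time l 0 l + 2 * l).

Section Fork.
Variables (c : seq data) (b : bool).
Hypothesis c0 : c <> [::].
Local Notation l := (size c).

(** The block after [i] shifts; after [l] shifts the copy stands next to the original. *)
Definition shifted i :=
  zip (map Some c ++ nseq i None) (nseq i None ++ map Some c).

Lemma size_shifted i : size (shifted i) = l + i.
Proof. by rewrite size_zip !size_cat size_map size_nseq [i + _]addnC minnn. Qed.

Lemma shifted_end : shifted l = map plain c ++ map shadow c.
Proof.
rewrite /shifted zip_cat ?size_map ?size_nseq //.
by congr cat; elim: (c) => //= d c' ->.
Qed.

Lemma shifted_both i : i < l ->
  has (fun g => isSome g.1 && isSome g.2) (shifted i).
Proof.
move=> il; apply/(has_nthP (None, None)); exists i; first by rewrite size_shifted; lia.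
rewrite nth_zip ?size_cat ?size_nseq 1?addnC // !nth_cat size_map il size_nseq ltnn subnn.
by case: (c) il => [|d c'] // il; rewrite (nth_map d).
Qed.

Lemma shifted_end_both : has (fun g => isSome g.1 && isSome g.2) (shifted l) = false.
Proof. by rewrite shifted_end has_cat !has_map; apply/norP; split; apply/hasPn. Qed.

Lemma blk_copy acc p :
  iter (2 * l) (go Yq) (blk acc p (Rcopy b) (map plain c)) =
  blk acc p (Rshift b None) (shifted 0).
Proof.
have E : rsw (Rcopy b) (map plain c) = (Rcopy b, shifted 0).
  rewrite (@rsw_map _ _ (fun d => (Some d, Some d))) //; congr pair.
  by rewrite /shifted cats0 /=; elim: (c) => //= d c' ->.
have cn : map plain c <> [::] by case: (c) c0.
have kl : Rcopy b <> Rlose by [].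
have ku : uniform (Rcopy b) (map plain c) by [].
have := round_eq p kl ku cn E erefl (lsw_both _ _ _) (acc := acc).
rewrite cats0 shifted_both; last by case: (c) c0.
by rewrite addn0 size_map => /(_ _ _ erefl) ->.
Qed.

Lemma blk_shift acc p i : i < l ->
  iter (2 * (l + i)).+1 (go Yq) (blk acc p (Rshift b None) (shifted i)) =
  blk acc (~~ p) (if i.+1 < l then Rshift b None else Rsplit b) (shifted i.+1).
Proof.
move=> il.
have E := @rsw_shift b None (map Some c ++ nseq i None) (nseq i None ++ map Some c).
have sE : zip (map Some c ++ nseq i None) (belast None (nseq i None ++ map Some c)) ++
    [:: (None, last None (nseq i None ++ map Some c))] = shifted i.+1.
  rewrite -[[:: _]]/(zip [:: _] [:: _]) -zip_cat; last first.
    by rewrite size_belast !size_cat !size_nseq addnC.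
  rewrite [X in zip _ X]cats1 -lastI /shifted -catA; congr (zip (_ ++ _) _).
  by rewrite -[[:: None]]/(nseq 1 None) -nseqD addn1.
have sn : shifted i <> [::].
  by move/(congr1 size); rewrite size_shifted; case: (c) c0.
have kl : Rshift b None <> Rlose by [].
have ku : uniform (Rshift b None) (shifted i) by [].
rewrite !size_cat !size_nseq addnC in E.
have := round_eq p kl ku sn (E erefl) erefl (lsw_both _ _ _) (acc := acc).
rewrite sE size_shifted addn1 => /(_ _ _ erefl) ->.
have -> // : has (fun g : cont => isSome g.1 && isSome g.2) (shifted i.+1) = (i.+1 < l).
case: ltnP => [|li]; first exact: shifted_both.
by have -> : i.+1 = l by [lia]; rewrite shifted_end_both.
Qed.

Lemma blk_shifts acc p i j : i + j.+1 = l ->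
  iter (shift_time l i j.+1) (go Yq) (blk acc p (Rshift b None) (shifted i)) =
  blk acc (odd (shift_time l i j.+1) (+) p) (Rsplit b) (shifted l).
Proof.
elim: j i p => [|j IHj] i p ij.
  rewrite [shift_time _ _ _]/= add0n blk_shift; last by lia.
  rewrite addn1 in ij; rewrite ij ltnn oddS oddM /=; congr blk.
rewrite -[shift_time l i _]/(shift_time l i.+1 j.+1 + _) iterD blk_shift; last by lia.
rewrite ifT; last by lia.
rewrite IHj; last by lia.
by rewrite oddD oddS oddM /= addbT addNb addbN.
Qed.

(** After [l] steps the head has crossed the left half and cut the block. The right half then takes
    one round of [2 * l] steps, exactly the time the slow head needs to return in the left half. *)
Lemma blk_split acc p :
  iter (3 * l) (go Yq) (blk acc p (Rsplit b) (shifted l)) =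
  blk acc (odd l (+) p) (ret b) (map plain c) ++
  blk acc (odd l (+) p) (ret b) (lsw (LpopF b (Some q)) (map plain c)).2.
Proof.
have [s [z cE]] : exists s z, c = rcons s z.
  by case/lastP: (c) c0 => // s z _; exists s, z.
have [y [s' cE']] : exists y s', c = y :: s' by case: (c) c0 => // y s'; exists y, s'.
have sl : l = (size s).+1 by rewrite cE size_rcons.
have sl' : l = (size s').+1 by rewrite cE'.
have -> : 3 * l = 2 * l + (size s).+1 by lia.
have cat_cE : map plain c ++ map shadow c = map plain s ++ plain z :: map shadow c.
  by rewrite {1}cE map_rcons cat_rcons.
have shE : map shadow c = shadow y :: map shadow s' by rewrite cE'.
have ku : uniform (Rsplit b) (rcons (map plain s) (plain z)).
  by rewrite -map_rcons /uniform -map_comp (@constant_map _ _ true).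
have kl : Rsplit b <> Rlose by [].
rewrite iterD iterS shifted_end cat_cE.
have := @R_to [::] acc p (Rsplit b) (map plain s) (plain z) (map shadow c) kl ku.
rewrite size_map (@rsw_map _ _ plain) // => ->.
rewrite cat0s shE R_split // iter_go_cat ?closed_at_head // {1}sl.
have := @S_sweep (map plain s) acc (~~ (odd (size s) (+) p)) (ret b) (plain z) [::].
rewrite size_map => ->; rewrite cats1 -map_rcons -cE sl oddS addNb; congr cat.
have rE : rsw (Rsplit b) (map shadow c) = (Rsplit b, map plain c) by apply: rsw_map.
have ku' : uniform (Rsplit b) (map shadow c).
  by rewrite /uniform -map_comp (@constant_map _ _ false).
have cn : map shadow c <> [::] by rewrite shE.
have [o lE] := lsw_popF b (Some q) c.
have := round_eq (~~ (odd (size s) (+) p)) kl ku' cn rE erefl (surjective_pairing _) (acc := acc).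
rewrite cats0 lE => /(_ _ _ erefl) /=; rewrite size_map addn0 sl.
by rewrite /blk shE.
Qed.

Lemma blk_fork acc p :
  let p' := odd (fork_time l) (+) p in
  iter (fork_time l) (go Yq) (blk acc p (Rcopy b) (map plain c)) =
  blk acc p' (ret b) (map plain c) ++
  blk acc p' (ret b) (lsw (LpopF b (Some q)) (map plain c)).2.
Proof.
move=> p'; rewrite {}/p' /fork_time 2!iterD blk_copy.
have [j lE] : exists j, l = j.+1 by case: (c) c0 => // d c' _; exists (size c').
have := @blk_shifts acc p 0 j; rewrite -lE add0n => /(_ erefl) ->.
rewrite blk_split; congr (blk _ _ _ _ ++ blk _ _ _ _);
  by rewrite !oddD; case: (odd l); case: (odd (shift_time l 0 l)); case: (p).
Qed.

End Fork.
(** * Stacks *)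

(* Overflowing items are lost at the bottom. *)
Fixpoint stk (T : Type) n (s : seq T) : seq (option T) :=
  if n is n'.+1 then ohead s :: stk n' (behead s) else [::].

Fixpoint push (T : Type) (o : option T) (s : seq (option T)) : seq (option T) :=
  if s is x :: s' then if o is Some _ then o :: push x s' else s else [::].

Lemma size_stk (T : Type) n (s : seq T) : size (stk n s) = n.
Proof. by elim: n s => //= n IHn s; rewrite IHn. Qed.

Definition opush (T : Type) (o : option T) s := seq_of_opt o ++ s.

Lemma push_stk (T : Type) o n (s : seq T) : push o (stk n s) = stk n (opush o s).
Proof.
case: o => [v|]; last by case: n.
by elim: n v s => // n IHn v [|w s] /=; [case: n {IHn} | rewrite IHn].
Qed.

Lemma rcons_stk (T : Type) n (s : seq T) : size s <= n -> rcons (stk n s) None = stk n.+1 s.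
Proof.
elim: n s => [|n IHn] s; first by case: s.
by move=> sn /=; rewrite IHn // size_behead; case: (size s) sn.
Qed.

Lemma stk_full (T : Type) (s : seq T) : stk (size s) s = map Some s.
Proof. by elim: s => //= x s ->. Qed.

Lemma stk_take (T : Type) n (s : seq T) : stk n (take n s) = stk n s.
Proof. by elim: n s => [|n IHn] [|x s] //=; rewrite IHn. Qed.

Definition mk (u : seq usym) (a b : seq (option Q)) (c : seq (option usym)) : seq data :=
  zip (zip (zip u a) b) c.

Lemma size_mk u a b c : size a = size u -> size b = size u -> size c = size u ->
  size (mk u a b c) = size u.
Proof. by move=> sa sb sc; rewrite !size_zip sa sb sc !minnn. Qed.

Lemma push_None (T : Type) (s : seq (option T)) : push None s = s.
Proof. by case: s. Qed.

Lemma rsw_rev u a b c o : size a = size u -> size b = size u -> size c = size u ->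
  exists o', rsw (Rrev o) (map plain (mk u a b c)) = (Rrev o', map plain (mk u a (push o b) c)).
Proof.
elim: u a b c o => [|u0 u' IHu].
  by move=> [|? ?] [|? ?] [|? ?] // o; exists o.
move=> [|a0 a'] [|b0 b'] [|c0 c'] // o [sa] [sb] [sc].
case: o => [v|] /=; last first.
  by have [o' E] := IHu _ _ _ None sa sb sc; exists o'; rewrite E push_None.
by have [o' E] := IHu _ _ _ b0 sa sb sc; exists o'; rewrite E.
Qed.

Lemma rsw_old u a b c y x o : size a = size u -> size b = size u -> size c = size u ->
  exists o', rsw (Rold y x o) (map plain (mk u a b c)) = (Rold y x o', map plain (mk u (push o a) b c)).
Proof.
elim: u a b c o => [|u0 u' IHu].
  by move=> [|? ?] [|? ?] [|? ?] // o; exists o.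
move=> [|a0 a'] [|b0 b'] [|c0 c'] // o [sa] [sb] [sc].
case: o => [v|] /=; last first.
  by have [o' E] := IHu _ _ _ None sa sb sc; exists o'; rewrite E push_None.
by have [o' E] := IHu _ _ _ a0 sa sb sc; exists o'; rewrite E.
Qed.

Lemma rsw_born u a b c y x o : size a = size u -> size b = size u -> size c = size u ->
  exists o', rsw (Rborn y x o) (map plain (mk u a b c)) = (Rborn y x o', map plain (mk u (push o a) b c)).
Proof.
elim: u a b c o => [|u0 u' IHu].
  by move=> [|? ?] [|? ?] [|? ?] // o; exists o.
move=> [|a0 a'] [|b0 b'] [|c0 c'] // o [sa] [sb] [sc].
case: o => [v|] /=; last first.
  by have [o' E] := IHu _ _ _ None sa sb sc; exists o'; rewrite E push_None.
by have [o' E] := IHu _ _ _ a0 sa sb sc; exists o'; rewrite E.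
Qed.

Lemma rsw_idle u a b c k : k = RtoB \/ k = RtoC \/ k = Rchk -> rsw k (map plain (mk u a b c)) = (k, (map plain (mk u a b c))).
Proof. by move=> kE; apply: rsw_map => -[[[? ?] ?] ?]; case: kE => [->|[->|->]]. Qed.

Lemma lsw_go u a b c k : lsw (Lgo k) (map plain (mk u a b c)) = (Lgo k, (map plain (mk u a b c))).
Proof. by apply: lsw_map => -[[[? ?] ?] ?]. Qed.

(** [K] stands for any of the modes [LpopK], [LpopF] and [LpopT]. *)
Lemma lsw_popA u a b c v (K : option Q -> lmode) :
    size a = size u -> size b = size u -> size c = size u ->
    (forall w u0 a0 b0 c0, fl (K w) (plain (u0, a0, b0, c0)) = (K a0, plain (u0, w, b0, c0))) ->
  lsw (K v) (map plain (mk u a b c)) = (K (head v a), map plain (mk u (behead (rcons a v)) b c)).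
Proof.
move=> + + + KE; elim: u a b c => [|u0 u' IHu].
  by move=> [|? ?] [|? ?] [|? ?].
move=> [|a0 a'] [|b0 b'] [|c0 c'] // [sa] [sb] [sc].
by rewrite /= IHu // KE; case: a' {sa}.
Qed.

Lemma lsw_popB u a b c v (K : option Q -> lmode) :
    size a = size u -> size b = size u -> size c = size u ->
    (forall w u0 a0 b0 c0, fl (K w) (plain (u0, a0, b0, c0)) = (K b0, plain (u0, a0, w, c0))) ->
  lsw (K v) (map plain (mk u a b c)) = (K (head v b), map plain (mk u a (behead (rcons b v)) c)).
Proof.
move=> + + + KE; elim: u a b c => [|u0 u' IHu].
  by move=> [|? ?] [|? ?] [|? ?].
move=> [|a0 a'] [|b0 b'] [|c0 c'] // [sa] [sb] [sc].
by rewrite /= IHu // KE; case: b' {sb}.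
Qed.

Lemma lsw_popC u a b c v : size a = size u -> size b = size u -> size c = size u ->
  lsw (LpopC v) (map plain (mk u a b c)) = (LpopC (head v c), map plain (mk u a b (behead (rcons c v)))).
Proof.
elim: u a b c => [|u0 u' IHu].
  by move=> [|? ?] [|? ?] [|? ?].
move=> [|a0 a'] [|b0 b'] [|c0 c'] // [sa] [sb] [sc].
by rewrite /= IHu //; case: c' {sc}.
Qed.

Definition tape acc p k u (a b : seq Q) (c : seq usym) :=
  let n := size u in blk acc p k (map plain (mk u (stk n a) (stk n b) (stk n c))).

Section Rounds.
Variables (acc p : bool) (u : seq usym).
Hypothesis u0 : 0 < size u.
Local Notation n := (size u).
Local Notation Tape := (tape acc p).

Lemma pop_stk (T : Type) (s : seq T) : size s <= n -> behead (rcons (stk n s) None) = stk n (behead s).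
Proof. by move=> sn; rewrite rcons_stk. Qed.

Lemma head_stk (T : Type) (s : seq T) v : head v (stk n s) = ohead s.
Proof. by case: n u0. Qed.

Lemma tape_round k a b c k1 a1 b1 c1 l l1 a2 b2 c2 k2 :
    k <> Rlose -> is_split k = false ->
    rsw k (map plain (mk u (stk n a) (stk n b) (stk n c))) =
      (k1, map plain (mk u (stk n a1) (stk n b1) (stk n c1))) ->
    turnR k1 = (l, None) ->
    lsw l (map plain (mk u (stk n a1) (stk n b1) (stk n c1))) =
      (l1, map plain (mk u (stk n a2) (stk n b2) (stk n c2))) ->
    turnL acc l1 = (acc, k2) ->
  iter (2 * n) (go Yq) (Tape k u a b c) = Tape k2 u a2 b2 c2.
Proof.
move=> kl ks rE tE lE tlE.
have ku : uniform k (map plain (mk u (stk n a) (stk n b) (stk n c))).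
  by rewrite /uniform ks.
have sn : size (map plain (mk u (stk n a) (stk n b) (stk n c))) = n.
  by rewrite size_map size_mk ?size_stk.
have c0 : map plain (mk u (stk n a) (stk n b) (stk n c)) <> [::].
  by move/(congr1 size); rewrite sn; case: n u0.
have := round_eq p kl ku c0 rE tE _ tlE; rewrite cats0 => /(_ _ lE).
by rewrite sn addn0.
Qed.

Lemma tape_RtoB a b c : size b <= n ->
  iter (2 * n) (go Yq) (Tape RtoB u a b c) =
  Tape (if b is _ :: _ then Rcopy false else RtoC) u a (behead b) c.
Proof.
move=> sb; apply: (tape_round (k1 := RtoB)) => //.
- by rewrite rsw_idle; auto.
- by rewrite (@lsw_popB _ _ _ _ _ LpopB) ?size_stk // pop_stk.
- by rewrite head_stk /=; case: b {sb}.
Qed.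

Lemma tape_RtoC a b c : size c <= n ->
  iter (2 * n) (go Yq) (Tape RtoC u a b c) =
  Tape (match c with
        | inl true :: _ => Rrev None | inl false :: _ => RtoC | _ => Rchk
        end) u a b (behead c).
Proof.
move=> sc; apply: (tape_round (k1 := RtoC)) => //.
- by rewrite rsw_idle; auto.
- by rewrite lsw_popC ?size_stk // pop_stk.
- by rewrite head_stk /=; case: c {sc} => // -[[]|].
Qed.

Lemma tape_Rchk a b c : size a <= n ->
  iter (2 * n) (go Yq) (Tape Rchk u a b c) =
  Tape (if good acc (ohead a) then Rlose else Rgrow true (inl false)) u (behead a) b c.
Proof.
move=> sa; apply: (tape_round (k1 := Rchk)) => //.
- by rewrite rsw_idle; auto.
- by rewrite (@lsw_popA _ _ _ _ _ LpopK) ?size_stk // pop_stk.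
- by rewrite head_stk.
Qed.

Lemma tape_rev o a b c : size a <= n ->
  iter (2 * n) (go Yq) (Tape (Rrev o) u a b c) =
  Tape (if a is x :: _ then Rrev (Some x) else Rborn q q None) u (behead a) (opush o b) c.
Proof.
move=> sa; have [o' E] := @rsw_rev u _ _ _ o (size_stk n a) (size_stk n b) (size_stk n c); rewrite push_stk in E.
apply: (tape_round _ _ E) => //.
- by rewrite (@lsw_popA _ _ _ _ _ LpopT) ?size_stk // pop_stk.
- by rewrite head_stk; case: a {sa E}.
Qed.

Lemma tape_old y x o a b c :
  iter (2 * n) (go Yq) (Tape (Rold y x o) u a b c) =
  Tape (Rborn y x (born y x)) u (opush o a) b c.
Proof.
have [o' E] := @rsw_old u _ _ _ y x o (size_stk n a) (size_stk n b) (size_stk n c); rewrite push_stk in E.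
exact: (tape_round _ _ E erefl (lsw_go _ _ _ _ _)).
Qed.

Lemma tape_born y x o a b c : size b <= n ->
  iter (2 * n) (go Yq) (Tape (Rborn y x o) u a b c) =
  Tape (if b is w :: _ then Rold w y (Some (delta w y x)) else Rcopy true)
    u (opush o a) (behead b) c.
Proof.
move=> sb; have [o' E] := @rsw_born u _ _ _ y x o (size_stk n a) (size_stk n b) (size_stk n c); rewrite push_stk in E.
apply: (tape_round _ _ E) => //.
- by rewrite (@lsw_popB _ _ _ _ _ (LpopS y x)) ?size_stk // pop_stk.
- by rewrite head_stk; case: b {sb E}.
Qed.

Lemma tape_rev_loop o a b c : size a <= n ->
  iter (2 * n * (size a).+1) (go Yq) (Tape (Rrev o) u a b c) =
  Tape (Rborn q q None) u [::] (catrev a (opush o b)) c.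
Proof.
elim: a o b => [|x a IHa] o b sa; first by rewrite muln1 tape_rev.
rewrite mulnS addnC iterD tape_rev //= IHa //; exact: ltnW.
Qed.

(** Computes [expand] from right to left: [b] is the reversed window, and [y], [x] are the two cells
    to the right of its top. The popped [w] is the missing left neighbour of [y], so that the
    updated [y] and the cell born before it can be pushed. *)
Fixpoint expand_rev y x (b a : seq Q) : seq Q :=
  if b is w :: b' then expand_rev w y b' (opush (born w y) (delta w y x :: a)) else a.

Lemma expand_revE (s r : seq Q) : expand_rev q q (catrev s r) [::] =
  expand_rev (nth q s 0) (nth q s 1) r (expand s).
Proof. by elim: s r => [|y s IHs] r //=; rewrite IHs. Qed.

Lemma tape_born_loop y x o a b c : size b <= n ->
  iter (2 * n + 4 * n * size b) (go Yq) (Tape (Rborn y x o) u a b c) =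
  Tape (Rcopy true) u (expand_rev y x b (opush o a)) [::] c.
Proof.
elim: b y x o a => [|w b IHb] y x o a sb; first by rewrite muln0 addn0 tape_born.
have -> : 2 * n + 4 * n * (size b).+1 = (2 * n + 4 * n * size b) + (2 * n + 2 * n) by lia.
rewrite iterD (iterD (2 * n) (2 * n)) tape_born // tape_old IHb //; exact: ltnW.
Qed.

(** Reversing takes [n.+1] rounds; rebuilding takes two rounds per cell and a final one. The bottom
    of [A] is the right end of the window, so the overflow of the stack is the truncation in
    [wstep]. *)
Lemma tape_step a c : size a = n ->
  iter (2 * n * n.+1 + (2 * n + 4 * n * n)) (go Yq) (Tape (Rrev None) u a [::] c) =
  Tape (Rcopy true) u (wstep a) [::] c.
Proof.
move=> sa; rewrite addnC iterD; have := @tape_rev_loop None a [::] c.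
rewrite sa => -> //; rewrite /opush /=.
have := @tape_born_loop q q None [::] (catrev a [::]) c.
rewrite size_rev sa => -> //.
by rewrite expand_revE /= /tape /wstep sa stk_take.
Qed.

End Rounds.

Lemma tape_fork acc p i u a b c : 0 < size u -> size a = size u ->
  let p' := odd (fork_time (size u)) (+) p in
  iter (fork_time (size u)) (go Yq) (tape acc p (Rcopy i) u a b c) =
  tape acc p' (ret i) u a b c ++ tape acc p' (ret i) u (popq a) b c.
Proof.
move=> u0 sa p'; set n := size u.
have sn : size (mk u (stk n a) (stk n b) (stk n c)) = n by rewrite size_mk ?size_stk.
have c0 : mk u (stk n a) (stk n b) (stk n c) <> [::].
  by move/(congr1 size); rewrite sn /n; case: size u0.
have := blk_fork i c0 acc p; rewrite sn /= -/n -/p' => ->; congr cat.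
rewrite (@lsw_popA _ _ _ _ _ (LpopF i)) ?size_stk //=; congr (blk _ _ _ (map plain (mk _ _ _ _))).
have sp : size (popq a) = n by rewrite size_popq sa.
have -> : stk n (popq a) = map Some (popq a) by rewrite -sp stk_full.
have -> : stk n a = map Some a by rewrite /n -sa stk_full.
by rewrite /popq map_rcons; move: sa u0; case: (a) => [<-|].
Qed.

(** * Phases *)

Lemma closed_blk acc p k c : c <> [::] -> closed (blk acc p k c).
Proof. by case: c => // x c _; apply: closed_at_head. Qed.

Lemma closed_tape acc p k u a b c : 0 < size u -> closed (tape acc p k u a b c).
Proof.
move=> u0; apply: closed_blk => /(congr1 size).
by rewrite size_map size_mk ?size_stk //; case: size u0.
Qed.

Fixpoint forks_time n j :=
  if j is j'.+1 then forks_time n j' + (2 * n + fork_time n) else 0.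

(** The counter in [B] holds [j.-1] items because the round leading to [Rcopy] has already popped
    one. *)
Lemma tape_forks acc p u a c j : 0 < size u -> size a = size u -> j <= size u ->
  let p' := odd (forks_time (size u) j) (+) p in
  iter (forks_time (size u) j) (go Yq)
    (tape acc p (if j is _.+1 then Rcopy false else RtoC) u a (nseq j.-1 q) c) =
  flatten [seq tape acc p' RtoC u A [::] c | A <- forks j a].
Proof.
move=> u0; elim: j a p => [|j IHj] a p sa ju p'; first by rewrite /= cats0.
have sp : size (popq a) = size u by rewrite size_popq sa.
have E A p1 : size A = size u ->
    iter (forks_time (size u) j + 2 * size u) (go Yq) (tape acc p1 RtoB u A (nseq j q) c) =
    flatten [seq tape acc (odd (forks_time (size u) j) (+) p1) RtoC u B [::] c | B <- forks j A].
  move=> sA; rewrite iterD tape_RtoB ?size_nseq //; last exact: ltnW.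
  by rewrite -(IHj A p1 sA (ltnW ju)); case: (j).
rewrite [forks_time _ _]/= addnA iterD tape_fork // iter_go_cat ?closed_tape // !E //.
rewrite -flatten_cat -map_cat /p' [forks_time _ _.+1]/= 2!oddD oddM /=.
by rewrite -!addbA.
Qed.

Definition step_time n := 2 * n * n.+1 + (2 * n + 4 * n * n).

Fixpoint walk_time n (pads : seq bool) :=
  if pads is b :: pads' then
    walk_time n pads' + ((if b then fork_time n + step_time n else 0) + 2 * n)
  else 2 * n.

Lemma odd_step_time n : odd (step_time n) = false.
Proof. by rewrite /step_time 2!oddD !oddM. Qed.

(** Every padding costs one pop, and [true] also a simulated step and a fork; the first input symbol
    [s] ends the walk. *)
Lemma tape_walk acc p u a pads s cs : 0 < size u -> size a = size u ->
    size pads + (size cs).+1 <= size u ->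
  let p' := odd (walk_time (size u) pads) (+) p in
  iter (walk_time (size u) pads) (go Yq)
    (tape acc p RtoC u a [::] (map inl pads ++ inr s :: cs)) =
  flatten [seq tape acc p' Rchk u A [::] cs | A <- walk (count id pads) a].
Proof.
move=> u0; elim: pads a p => [|b pads IHp] a p sa sc p'.
  by rewrite /p' /= cats0 tape_RtoC // oddM.
have sc' : size (map inl (b :: pads) ++ inr s :: cs) <= size u.
  by rewrite size_cat size_map.
case: b sc sc' @p' => sc sc' p'; rewrite [walk_time _ _]/= iterD; last first.
  rewrite tape_RtoC // IHp //; last exact: ltnW.
  by rewrite /p' /= oddD oddM addbF.
rewrite [iter (_ + 2 * _) _ _]iterD tape_RtoC // iterD tape_step //.
rewrite tape_fork ?size_wstep // [ret _]/=.
have sp : size (popq (wstep a)) = size u by rewrite size_popq size_wstep sa.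
rewrite iter_go_cat ?closed_tape // !IHp ?size_wstep //; try exact: ltnW.
rewrite -flatten_cat -map_cat /p' [walk_time _ _]/=.
rewrite (oddD (walk_time _ _)) (oddD (_ + _)) (oddD (fork_time _)) oddM odd_step_time.
by rewrite !addbF -!addbA.
Qed.

Definition utrack (d : data) : usym := d.1.1.1.

Lemma blk_init acc p (c : seq data) : c <> [::] ->
  let u := map utrack c in
  iter (2 * size u) (go Yq) (blk acc p Rinit (map plain c)) =
  tape acc p (Rcopy false) u (map usym_val u) (nseq (size u).-1 q) u.
Proof.
move=> c0 u.
have su : size u = size c by rewrite size_map.
have rE : rsw Rinit (map plain c) =
    (Rinit, map plain (mk u (stk (size u) (map usym_val u)) (stk (size u) (nseq (size u) q))
       (stk (size u) u))).
  rewrite (@rsw_map _ _ (fun d => plain (utrack d, Some (usym_val (utrack d)), Some q, Some (utrack d))));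
    last by case=> [[[? ?] ?] ?].
  rewrite -[X in stk X (map _ u)](size_map usym_val) -[X in stk X (nseq _ q)](size_nseq (size u) q).
  rewrite !stk_full; congr pair; rewrite /u /mk.
  by elim: (c) => //= d c' ->.
have kl : Rinit <> Rlose by [].
have ku : uniform Rinit (map plain c) by [].
have cn : map plain c <> [::] by case: (c) c0.
have u0 : 0 < size u by rewrite su; case: (c) c0.
have := @lsw_popB u (stk (size u) (map usym_val u)) (stk (size u) (nseq (size u) q))
  (stk (size u) u) None LpopB.
rewrite !size_stk => /(_ erefl erefl erefl (fun _ _ _ _ _ => erefl)) lE.
have := round_eq p kl ku cn rE erefl (acc := acc); rewrite cats0 => /(_ _ _ _ _ lE).
rewrite size_map addn0 -su head_stk // pop_stk ?size_nseq //.
have -> : behead (nseq (size u) q) = nseq (size u).-1 q by case: (size u).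
by move=> /(_ acc (Rcopy false)) ->; last by case: (size u) u0.
Qed.

Lemma size_walk t (A : seq Q) : 0 < size A -> {in walk t A, forall B, size B = size A}.
Proof.
elim: t A => [|t IHt] A A0 B; first by rewrite inE => /eqP ->.
by rewrite /= mem_cat => /orP[] /IHt ->; rewrite ?size_popq ?size_wstep.
Qed.

Definition phase_time n pads := 2 * n + (walk_time n pads + (forks_time n n + 2 * n)).

(** Only the track [U] of [c] is prescribed, since [Rinit] overwrites the others; so a block that
    failed can start again whatever its stacks contain. *)
Lemma phase acc p pads (w : seq Sigma) (c : seq data) : w <> [::] ->
  let u := map inl pads ++ map inr w in
  let p' := odd (phase_time (size u) pads) (+) p in
    map utrack c = u ->
  iter (phase_time (size u) pads) (go Yq) (blk acc p Rinit (map plain c)) =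
  flatten [seq tape acc p' (if good acc (Some (nth q A 0)) then Rlose else Rgrow true (inl false))
                 u (behead A) [::] (behead (map inr w))
          | A <- leaves (count id pads) (map usym_val u)].
Proof.
case: w => // s w _ u p' cE.
have u0 : 0 < size u by rewrite size_cat addnS.
have c0 : c <> [::] by move=> c0; move: u0; rewrite -cE c0.
set n := size u in u0 p' *; set t := count id pads; set a0 := map usym_val u.
have sa0 : size a0 = n by rewrite size_map.
have initE : iter (2 * n) (go Yq) (blk acc p Rinit (map plain c)) =
    tape acc p (Rcopy false) u a0 (nseq n.-1 q) u.
  by have := blk_init acc p c0; rewrite /= cE.
have forksE := tape_forks acc p u u0 sa0 (leqnn n).
rewrite -/n (_ : (if n is _.+1 then _ else _) = Rcopy false) in forksE; last by case: (n) u0.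
have sc : size pads + (size (map inr w : seq usym)).+1 <= n.
  by rewrite /n size_cat !size_map.
set p1 := odd (forks_time n n) (+) p in forksE.
set p2 := odd (walk_time n pads) (+) p1.
have p'E : p' = p2.
  rewrite /p' /phase_time (oddD (2 * n)) oddM (oddD (walk_time _ _)) (oddD (forks_time _ _)).
  by rewrite oddM /= addbF -addbA.
have walkE A : A \in forks n a0 ->
    iter (2 * n + walk_time n pads) (go Yq) (tape acc p1 RtoC u A [::] u) =
    flatten [seq tape acc p2 (if good acc (Some (nth q B 0)) then Rlose else Rgrow true (inl false))
                 u (behead B) [::] (map inr w) | B <- walk t A].
  move=> AF; have sA : size A = n by rewrite (size_forks _ AF) sa0.
  rewrite iterD [in tape _ _ _ _ _ _ u]/u tape_walk //.
  rewrite iter_go_flatten; last by apply/allP => x /mapP[B _ ->]; apply: closed_tape.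
  rewrite -map_comp; congr flatten; apply/eq_in_map => B BW /=.
  have sB : size B = n by rewrite (size_walk _ BW) ?sA.
  rewrite tape_Rchk ?sB // (_ : ohead B = Some (nth q B 0)) //.
  by case: (B) sB u0 => [<-|].
rewrite /phase_time addnA iterD (iterD (forks_time n n)) initE forksE.
rewrite iter_go_flatten; last by apply/allP => x /mapP[B _ ->]; apply: closed_tape.
rewrite /leaves sa0 p'E -map_comp.
have /eq_in_map -> : {in forks n a0,
    iter (2 * n + walk_time n pads) (go Yq) \o (fun A => tape acc p1 RtoC u A [::] u) =1
    fun A => flatten [seq tape acc p2
      (if good acc (Some (nth q B 0)) then Rlose else Rgrow true (inl false))
      u (behead B) [::] (map inr w) | B <- walk t A]} by exact: walkE.
by elim: (forks n a0) => //= A F IHF; rewrite map_cat flatten_cat -IHF.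
Qed.

(** * Adding two paddings after a failed test *)

Lemma rsw_grow i v (c : seq data) : exists2 c1 : seq data,
  rsw (Rgrow i v) (map plain c) = (Rgrow i (last v (map utrack c)), map plain c1) &
  map utrack c1 = belast v (map utrack c).
Proof.
elim: c v => [|[[[u a] b] c] cs IHc] v; first by exists [::].
have [c1 E E1] := IHc u; exists ((v, a, b, c) :: c1); first by rewrite /= E.
by rewrite /= E1.
Qed.

Lemma blk_grow acc p i v (c : seq data) : c <> [::] -> exists2 c' : seq data,
  iter (2 * size c + 1) (go Yq) (blk acc p (Rgrow i v) (map plain c)) =
  (if i then blk acc (~~ p) (Rgrow false (inl (~~ acc))) (map plain c')
   else blk (~~ acc) (~~ p) Rinit (map plain c')) &
  map utrack c' = v :: map utrack c.
Proof.
move=> c0; have [c1 rE uE] := rsw_grow i v c.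
pose d : data := (last v (map utrack c), None, None, None).
exists (rcons c1 d); last by rewrite map_rcons uE lastI.
have kl : Rgrow i v <> Rlose by [].
have ku : uniform (Rgrow i v) (map plain c) by [].
have cn : map plain c <> [::] by case: (c) c0.
have lE : lsw (if i then Lgrow else Lflip) (map plain c1 ++ seq_of_opt (Some (plain d))) =
    (if i then Lgrow else Lflip, map plain (rcons c1 d)).
  rewrite cats1 -map_rcons; by apply: lsw_map => -[[[? ?] ?] ?]; case: (i).
have := round_eq p kl ku cn rE erefl lE (acc := acc); rewrite size_map.
by case: (i) => /(_ _ _ erefl).
Qed.

(** The new top padding counts as a step exactly after a reject phase, so that both phases for the
    same [t] simulate [t] steps. *)
Lemma blk_grow2 acc p (c : seq data) : c <> [::] -> exists2 c' : seq data,
  iter (4 * size c + 4) (go Yq) (blk acc p (Rgrow true (inl false)) (map plain c)) =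
  blk (~~ acc) p Rinit (map plain c') &
  map utrack c' = [:: inl (~~ acc), inl false & map utrack c].
Proof.
move=> c0; have [c1 E1 U1] := blk_grow acc p true (inl false) c0.
have s1 : size c1 = (size c).+1 by rewrite -(size_map utrack) U1 /= size_map.
have c1n : c1 <> [::] by move/(congr1 size); rewrite s1.
have [c2 E2 U2] := blk_grow acc (~~ p) false (inl (~~ acc)) c1n.
exists c2; last by rewrite U2 U1.
have -> : 4 * size c + 4 = 2 * size c1 + 1 + (2 * size c + 1) by lia.
by rewrite iterD E1 E2 negbK.
Qed.

(** * Turning a block into alternating cells *)

Lemma go_lost l i p t : go l (nseq i (lost p) ++ t) =
  nseq i (lost (~~ p)) ++ go (last l (nseq i (lost p))) t.
Proof. by elim: i l => //= i IHi l; rewrite go_cons IHi; case: p {IHi}. Qed.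

Lemma iter_lost T i p : iter T (go Yq) (nseq i (lost p)) = nseq i (lost (odd T (+) p)).
Proof.
elim: T => //= T ->; have := go_lost Yq i (odd T (+) p) [::].
by rewrite !cats0 addNb.
Qed.

Definition losing i f acc p (x : cont) c2 :=
  nseq i (lost p) ++ lay f true ((Some (acc, p, HR Rlose), x) :: map bare c2).

Lemma losing_move i f acc p x y c2 :
  go Yq (losing i f acc p x (y :: c2)) = losing i.+1 false acc (~~ p) y c2.
Proof.
rewrite /losing go_lost [lay f _ _]/= go_cons.
rewrite -[i.+1]addn1 nseqD -catA; congr cat; rewrite /= go_cons.
have -> : ydelta (Ycell f false (Some (acc, p, HR Rlose)) x)
    (Ycell false (nilp (map bare c2)) None y) (head Yq (lay false true (map bare c2))) =
    Ycell false (nilp (map bare c2)) (Some (acc, ~~ p, HR Rlose)) y.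
  by case: x => [[[[[? ?] ?] ?]|] ?].
rewrite go_idle_end; last by case: nilp.
by case: nilp.
Qed.

Lemma losing_wait i f acc x : go Yq (losing i f acc acc x [::]) = losing i f acc (~~ acc) x [::].
Proof.
rewrite /losing go_lost [lay f _ _]/= go_cons /= /act eqxx /=.
by case: x => [[[[[? ?] ?] ?]|] ?].
Qed.

Lemma losing_end i f acc p x : p != acc ->
  go Yq (losing i f acc p x [::]) = nseq i.+1 (lost (~~ p)).
Proof.
move=> pa; rewrite /losing go_lost -[i.+1]addn1 nseqD; congr cat.
rewrite [lay f _ _]/= go_cons /= /act (negPf pa) /=.
by case: x => [[[[[? ?] ?] ?]|] ?].
Qed.

(** One extra step if the alternating cells would show the wrong answer after [n] steps. *)
Definition wait acc p n : nat := odd n (+) p != acc.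

Lemma losing_iter i f acc p x c2 : iter (size c2) (go Yq) (losing i f acc p x c2) =
  losing (i + size c2) (f && nilp c2) acc (odd (size c2) (+) p) (last x c2) [::].
Proof.
elim: c2 i f p x => [|y c2 IHc] i f p x; first by rewrite addn0 andbT.
rewrite [size _]/= iterSr losing_move IHc /= andbF addSnnS.
by rewrite addbN addNb.
Qed.

(** A single such cell keeps [Y] from halting. *)
Definition is_cell (x : ystate) := match x with Yq | Ya | Yr => false | _ => true end.

Lemma has_cell_losing i f acc p x c2 : has is_cell (losing i f acc p x c2).
Proof. by rewrite has_cat /= orbT. Qed.

Lemma go_dead l w : ~~ has is_cell w -> ~~ has is_cell (go l w).
Proof.
elim: w l => [|x w IHw] l // /norP[xc /(IHw x) wd].
rewrite go_cons /= has_cat !negb_or wd andbT.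
by case: x xc {wd}.
Qed.

Lemma iter_dead T w : ~~ has is_cell w -> ~~ has is_cell (iter T (go Yq) w).
Proof. by move=> wd; elim: T => //= T; apply: go_dead. Qed.

(** Such cells never reappear once they are all gone. So finding one just before the halting time
    excludes every earlier halt. *)
Lemma has_cell_before T T' w : T' <= T ->
  has is_cell (iter T (go Yq) w) -> has is_cell (iter T' (go Yq) w).
Proof.
move=> T'T; apply: contraTT => /(iter_dead (T - T')).
by rewrite -iterD subnK.
Qed.

Lemma wait_le1 acc p n : wait acc p n <= 1.
Proof. exact: leq_b1. Qed.

Lemma wait_parity acc p n : odd (n + wait acc p n) (+) p = acc.
Proof. by rewrite oddD /wait oddb; case: (odd n); case: p; case: acc. Qed.

Lemma blk_lose acc p c : c <> [::] -> let T := size c + wait acc p (size c) in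
  iter T (go Yq) (blk acc p Rlose c) = nseq (size c) (lost acc) /\
  has is_cell (iter T.-1 (go Yq) (blk acc p Rlose c)).
Proof.
case: c => // x c2 _ T.
have E := losing_iter 0 true acc p x c2; rewrite -[losing 0 _ _ _ _ _]/(blk acc p Rlose (x :: c2)) in E.
set v := odd (size c2) (+) p in E.
have -> : T = (size c2).+1 + (v == acc).
  by rewrite /T /wait /= addNb -/v; case: (v); case: (acc).
case: (eqVneq v acc) => [pE|pE].
  rewrite addn1 /= E pE losing_wait has_cell_losing losing_end; last by case: (acc).
  by rewrite negbK.
rewrite addn0 /= E losing_end // has_cell_losing; split=> //.
by congr (nseq _ (lost _)); move: pE; case: (v); case: (acc).
Qed.

Lemma blk_lose_ge acc p c T : c <> [::] -> size c + wait acc p (size c) <= T ->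
  iter T (go Yq) (blk acc p Rlose c) = nseq (size c) (lost (odd T (+) p)).
Proof.
move=> c0 leT; rewrite -(subnK leT) iterD (blk_lose acc p c0).1 iter_lost oddD -addbA.
by rewrite wait_parity.
Qed.

Lemma utrack_mk u a b c : size a = size u -> size b = size u -> size c = size u ->
  map utrack (mk u a b c) = u.
Proof. by elim: u a b c => [|? u IHu] [|? a] [|? b] [|? c] //= [?] [?] [?]; rewrite IHu. Qed.

(* Between two phases, all that remains are alternating cells and blocks about to
start the next phase. *)
Definition okseg acc p us s :=
  (exists2 m, 0 < m & s = nseq m (lost p)) \/
  (exists2 c, s = blk acc p Rinit (map plain c) & map utrack c = us).

(** At least one block must be alive: it is the witness that [Y] has not halted yet. *)
Definition conf acc p us x := exists segs,
  [/\ x = flatten segs, {in segs, forall s, okseg acc p us s} &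
      exists2 c, blk acc p Rinit (map plain c) \in segs & map utrack c = us].

Lemma closed_lost m p : 0 < m -> closed (nseq m (lost p)).
Proof.
case: m => // m _; rewrite /closed /=; case: p => /=; elim: m => //=.
Qed.

Lemma okseg_closed acc p us s : us <> [::] -> okseg acc p us s -> closed s.
Proof.
move=> u0 [[m m0 ->]|[c -> cE]]; first exact: closed_lost.
by apply: closed_blk; case: c cE u0 => // <-.
Qed.

Lemma leaves_neq0 t (A : seq Q) : leaves t A <> [::].
Proof.
have W (B : seq Q) : exists C, C \in walk t B.
  by elim: t B => [|t IHt] B; [exists B; rewrite inE |
    have [C CW] := IHt (wstep B); exists C; rewrite /= mem_cat CW].
have F n (B : seq Q) : exists C, C \in forks n B.
  by elim: n B => [|n IHn] B; [exists B; rewrite inE |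
    have [C CW] := IHn B; exists C; rewrite /= mem_cat CW].
have [B BF] := F (size A) A; have [C CW] := W B.
have : C \in leaves t A by apply/flatten_mapP; exists B.
by case: leaves.
Qed.

(** * The outcome of one phase *)

Section Phase.
Variables (acc p : bool) (pads : seq bool) (w : seq Sigma).
Hypothesis w0 : w <> [::].
Local Notation u := (map inl pads ++ map inr w).
Local Notation n := (size u).
Local Notation lv := (leaves (count id pads) (map usym_val u)).
Local Notation T1 := (phase_time n pads).
Local Notation p1 := (odd T1 (+) p).
Local Notation top_good A := (good acc (Some (nth q A 0))).

Lemma u_neq0 : 0 < n.
Proof. by rewrite size_cat !size_map; case: w w0 => // *; rewrite addnS. Qed.

Lemma u_nil : u <> [::].
Proof. by move=> E; have := u_neq0; rewrite E. Qed.

Lemma size_tape_mk (a b : seq Q) (c : seq usym) :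
  size (mk u (stk n a) (stk n b) (stk n c)) = n.
Proof. by rewrite size_mk ?size_stk. Qed.

Lemma tape_mk_nil (a b : seq Q) (c : seq usym) :
  map plain (mk u (stk n a) (stk n b) (stk n c)) <> [::].
Proof.
move/(congr1 size); rewrite size_map size_tape_mk => E.
by have := u_neq0; rewrite E.
Qed.

(** A bad leaf takes [4 * n + 4] steps to add its paddings; a good leaf is alternating after at most
    [n + 1] steps, so both fit into the same [T]. *)
Lemma seg_fail s : let T := 4 * n + 4 + T1 in
  let P := okseg (~~ acc) (odd T (+) p) [:: inl (~~ acc), inl false & u] in
  okseg acc p u s -> exists segs,
  [/\ iter T (go Yq) s = flatten segs, {in segs, forall s', P s'} &
   (exists2 c, s = blk acc p Rinit (map plain c) & map utrack c = u) ->
   has (fun A => ~~ top_good A) lv ->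
   exists2 c, blk (~~ acc) (odd T (+) p) Rinit (map plain c) \in segs &
     map utrack c = [:: inl (~~ acc), inl false & u]].
Proof.
move=> T P; have pT : odd T (+) p = p1 by rewrite /T oddD oddD oddM /=.
case=> [[m m0 sE]|[c sE cE]].
  exists [:: nseq m (lost (odd T (+) p))]; split.
  - by rewrite sE iter_lost /= cats0.
  - by move=> s'; rewrite inE => /eqP ->; left; exists m.
  case=> c E cE _; exfalso; move: E; rewrite sE.
  case: c cE => [/esym/u_nil//|d c _]; case: m m0 {sE} => // m _.
  by case: (p).
pose t A := tape acc p1 (if top_good A then Rlose else Rgrow true (inl false))
                 u (behead A) [::] (behead (map inr w)).
have bad A : ~~ top_good A -> exists2 c', iter (4 * n + 4) (go Yq) (t A) =
    blk (~~ acc) p1 Rinit (map plain c') &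
    map utrack c' = [:: inl (~~ acc), inl false & u].
  move=> /negPf gA; rewrite /t gA.
  have cn : mk u (stk n (behead A)) (stk n [::]) (stk n (behead (map inr w))) <> [::].
    by move=> E; have := @tape_mk_nil (behead A) [::] (behead (map inr w)); rewrite E.
  have [c' E' U'] := blk_grow2 acc p1 cn.
  exists c'; first by rewrite size_tape_mk in E'.
  by rewrite U' utrack_mk ?size_stk.
exists [seq iter (4 * n + 4) (go Yq) (t A) | A <- lv]; split.
- rewrite /T iterD sE phase // iter_go_flatten -?map_comp //.
  by apply/allP => x /mapP[A _ ->]; apply: closed_tape u_neq0.
- move=> s' /mapP[A _ ->]; rewrite /P pT.
  case: (boolP (top_good A)) => gA; last by right; have [c' -> ?] := bad A gA; exists c'.
  left; exists n; first exact: u_neq0.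
  rewrite /t gA /tape blk_lose_ge; last 2 first.
  + exact: tape_mk_nil.
  + rewrite size_map size_tape_mk; have := wait_le1 acc p1 n; move: (wait _ _ _) => k; lia.
  by rewrite size_map size_tape_mk oddD oddM.
move=> _ /hasP[A AL gA]; have [c' E' U'] := bad A gA.
by exists c'; rewrite // pT -E'; apply: map_f.
Qed.

Lemma conf_fail x : let T := 4 * n + 4 + T1 in has (fun A => ~~ top_good A) lv ->
  conf acc p u x ->
  conf (~~ acc) (odd T (+) p) [:: inl (~~ acc), inl false & u] (iter T (go Yq) x).
Proof.
move=> T hbad [segs [-> ok [c cS cE]]].
rewrite iter_go_flatten; last first.
  by apply/allP => s /ok; apply: okseg_closed; apply: u_nil.
(* The existence of a live block becomes an implication, which can be proved by induction over the
   segments although some of them are already dead. *)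
suff [segs' [E ok' live]] : exists segs',
  [/\ flatten (map (iter T (go Yq)) segs) = flatten segs',
     {in segs', forall s, okseg (~~ acc) (odd T (+) p) [:: inl (~~ acc), inl false & u] s} &
     (exists2 c, blk acc p Rinit (map plain c) \in segs & map utrack c = u) ->
     exists2 c', blk (~~ acc) (odd T (+) p) Rinit (map plain c') \in segs' &
     map utrack c' = [:: inl (~~ acc), inl false & u]].
  by exists segs'; split=> //; apply: live; exists c.
elim: segs ok {cS} => [|s segs IHs] ok; first by exists [::]; split=> // -[].
have [|segs2 [E2 ok2 live2]] := IHs; first by move=> s' s'S; apply: ok; rewrite inE s'S orbT.
have [segs1 [E1 ok1 live1]] := seg_fail (ok s (mem_head _ _)).
exists (segs1 ++ segs2); split.
- by rewrite /= E1 E2 flatten_cat.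
- by move=> s'; rewrite mem_cat => /orP[/ok1|/ok2].
case=> c1; rewrite inE => /orP[/eqP sE|c1S] c1E.
  have [|c' c'S c'E] := live1 _ hbad; first by exists c1.
  by exists c' => //; rewrite mem_cat c'S.
have [|c' c'S c'E] := live2; first by exists c1.
by exists c' => //; rewrite mem_cat c'S orbT.
Qed.

Lemma seg_succ s : let T := n + wait acc p1 n + T1 in all (fun A => top_good A) lv ->
  okseg acc p u s -> exists2 m, 0 < m & iter T (go Yq) s = nseq m (lost acc).
Proof.
move=> T allg; have pT : odd T (+) p = acc by rewrite /T oddD -addbA wait_parity.
case=> [[m m0 ->]|[c -> cE]]; first by exists m; rewrite // iter_lost pT.
rewrite /T iterD phase // iter_go_flatten; last first.
  by apply/allP => x /mapP[A _ ->]; apply: closed_tape u_neq0.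
have := @leaves_neq0 (count id pads) (map usym_val u).
elim: lv allg => // A L IHL /= /andP[gA gL] _.
have E : iter (n + wait acc p1 n) (go Yq) (tape acc p1 Rlose u (behead A) [::] (behead (map inr w)))
    = nseq n (lost acc).
  have := (blk_lose acc p1 (@tape_mk_nil (behead A) [::] (behead (map inr w)))).1.
  by rewrite size_map size_tape_mk.
rewrite [_ || _]gA E; case: L IHL gL => [|A' L] IHL gL.
  by exists n; rewrite ?cats0 //; apply: u_neq0.
have [|m m0 Em] := IHL gL; first by [].
exists (n + m); first by rewrite addn_gt0 m0 orbT.
by rewrite Em nseqD.
Qed.

(** The second claim will make [T] the first halting time. *)
Lemma conf_succ x : let T := n + wait acc p1 n + T1 in all (fun A => top_good A) lv ->
  conf acc p u x ->
  (exists2 m, 0 < m & iter T (go Yq) x = nseq m (lost acc)) /\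
  has is_cell (iter T.-1 (go Yq) x).
Proof.
move=> T allg [segs [-> ok [c cS cE]]].
have cl : all closed segs.
  by apply/allP => s /ok; apply: okseg_closed; apply: u_nil.
rewrite !iter_go_flatten //; split.
  have: segs <> [::] by case: (segs) cS.
  elim: segs ok {cS cl} => // s segs IHs ok _.
  have [m m0 E] := seg_succ allg (ok s (mem_head _ _)).
  case: segs IHs ok => [|s' segs] IHs ok; first by exists m; rewrite //= E cats0.
  have [||m' m0' E'] := IHs => //; first by move=> s2 s2S; apply: ok; rewrite inE s2S orbT.
  exists (m + m'); first by rewrite addn_gt0 m0.
  have -> : flatten (map (iter T (go Yq)) [:: s, s' & segs]) =
    iter T (go Yq) s ++ flatten (map (iter T (go Yq)) (s' :: segs)) by [].
  by rewrite E E' nseqD.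
have {}u0 := u_neq0.
have TE : T.-1 = (n + wait acc p1 n).-1 + T1 by rewrite /T; lia.
suff /hasP[y yS yc] : has is_cell (iter T.-1 (go Yq) (blk acc p Rinit (map plain c))).
  apply/hasP; exists y => //; apply/flatten_mapP.
  by exists (blk acc p Rinit (map plain c)).
rewrite TE iterD phase // iter_go_flatten; last first.
  by apply/allP => x' /mapP[A _ ->]; apply: closed_tape.
have := @leaves_neq0 (count id pads) (map usym_val u).
case: lv allg => // A L /= /andP[gA _] _.
rewrite has_cat; apply/orP; left; rewrite [_ || _]gA.
have := (blk_lose acc p1 (@tape_mk_nil (behead A) [::] (behead (map inr w)))).2.
by rewrite size_map size_tape_mk.
Qed.

End Phase.

(** * The sequence of phases *)

Fixpoint pads_at j := if j is j'.+1 then [:: odd j', false & pads_at j'] else [::].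

Lemma size_pads_at j : size (pads_at j) = 2 * j.
Proof. by elim: j => //= j ->; lia. Qed.

Lemma count_pads_at j : count id (pads_at j) = j./2.
Proof. by elim: j => //= j ->; rewrite add0n uphalf_half. Qed.

Definition phase_len m pads := 4 * m + 4 + phase_time m pads.

(** Phase [j] treats the time [j./2], for acceptance if [j] is even and for rejection if it is odd.
    The initial [1] is the step that makes the input a block. *)
Fixpoint phase_start n j :=
  if j is j'.+1 then phase_len (2 * j' + n) (pads_at j') + phase_start n j' else 1.

Definition track_at (w : seq Sigma) j : seq usym := map inl (pads_at j) ++ map inr w.

Lemma size_track_at w j : size (track_at w j) = 2 * j + size w.
Proof. by rewrite size_cat !size_map size_pads_at. Qed.

Lemma start (w : seq Sigma) : w <> [::] ->
  conf true true (track_at w 0) (go Yq (map Yin w)).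
Proof.
case: w => // s w _; pose d s : data := (inr s, None, None, None).
have E s0 v : go (Yin s0) (map Yin v) = lay false true (map bare (map plain (map d v))).
  elim: v s0 => // s1 v IHv s0; rewrite map_cons go_cons [seq_of_opt _]/= IHv /=.
  by case: v {IHv}.
have -> : go Yq (map Yin (s :: w)) = blk true true Rinit (map plain (map d (s :: w))).
  by rewrite map_cons go_cons [seq_of_opt _]/= E /blk /run /= at_headE; case: (w).
have uE : map utrack (map d (s :: w)) = track_at (s :: w) 0.
  by rewrite /track_at /= -map_comp.
exists [:: blk true true Rinit (map plain (map d (s :: w)))]; split.
- by rewrite /= cats0.
- by move=> s'; rewrite inE => /eqP ->; right; exists (map d (s :: w)).
- by exists (map d (s :: w)); rewrite // inE.
Qed.

Definition query (w : seq Sigma) j :=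
  all_active_in (if odd j then Qrej else Qacc) (xconf X w j./2).

Lemma queryE w j : w <> [::] ->
  all (fun A => good (~~ odd j) (Some (nth q A 0)))
    (leaves (count id (pads_at j)) (map usym_val (track_at w j))) = query w j.
Proof.
move=> w0; rewrite count_pads_at /query -(@all_leaves _ _ _ _ (2 * j)); last 2 first.
- by case: w w0.
(* There are enough paddings: [3 * j./2 <= 2 * j]. *)
- by have := odd_double_half j; lia.
have -> : map usym_val (track_at w j) = nseq (2 * j) q ++ map (@inp _ X) w.
  rewrite map_cat -!map_comp; congr cat.
  by rewrite -size_pads_at; elim: (pads_at j) => //= b s ->.
by apply: eq_all => A; rewrite /good if_neg.
Qed.

Lemma reach w j : w <> [::] -> (forall i, i < j -> ~~ query w i) ->
  conf (~~ odd j) (odd (phase_start (size w) j)) (track_at w j)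
    (iter (phase_start (size w) j) (go Yq) (map Yin w)).
Proof.
move=> w0; elim: j => [|j IHj] bad; first exact: start.
have {}IHj := IHj (fun i ij => bad i (ltnW ij)).
have := bad j (ltnSn j); rewrite -queryE // -has_predC => hbad.
have := conf_fail w0 hbad IHj; rewrite -/(track_at w j) size_track_at.
by rewrite -iterD -oddD negbK.
Qed.

Lemma all_active_lost (A : {set xQ Y}) t m b :
  all_active_in A (nseq t Yq ++ nseq m (lost b) ++ nseq t Yq : seq (xQ Y)) =
  (m == 0) || (lost b \in A).
Proof.
rewrite /all_active_in !all_cat !all_nseq eqxx !orbT andbT /=.
by case: b.
Qed.

Lemma not_active_cell (A : {set xQ Y}) t w : A = [set Ya] \/ A = [set Yr] ->
  has is_cell w -> ~~ all_active_in A (nseq t Yq ++ w ++ nseq t Yq : seq (xQ Y)).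
Proof.
move=> AE /hasP[x xw xc]; apply/allPn; exists x; first by rewrite !mem_cat xw orbT.
by case: AE => ->; rewrite inE negb_or; case: x xc {xw}.
Qed.

Definition halt_time n j :=
  let m := 2 * j + n in
  m + wait (~~ odd j) (odd (phase_time m (pads_at j)) (+) odd (phase_start n j)) m
  + phase_time m (pads_at j) + phase_start n j.

Lemma Y_halts (w : seq Sigma) j : w <> [::] ->
    (forall i, i < j -> ~~ query w i) -> query w j ->
  let T := halt_time (size w) j in
  [/\ @halts_at _ Y [set Ya] [set Yr] w T,
      all_active_in [set lost (~~ odd j) : xQ Y] (xconf Y w T) &
      ~~ all_active_in [set lost (odd j) : xQ Y] (xconf Y w T)].
Proof.
move=> w0 bad goodj T; have C := reach w0 bad; rewrite -queryE // in goodj.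
have [[m m0 Em] live] := conf_succ w0 goodj C.
move: Em live; rewrite -/(track_at w j) size_track_at.
set T' := (X in iter X _ _ = _) => Em live.
have TE : T = T' + phase_start (size w) j by [].
have sw : 0 < size w by case: (w) w0.
have T'0 : 0 < T' by rewrite /T' !addn_gt0 sw orbT.
have ET : iter T (go Yq) (map Yin w) = nseq m (lost (~~ odd j)) by rewrite TE iterD.
have actT A : all_active_in A (xconf Y w T) = (lost (~~ odd j) \in A).
  by rewrite xconf_go ET all_active_lost; case: m m0 {Em ET}.
have before t : t < T -> has is_cell (iter t (go Yq) (map Yin w)).
  move=> tT; apply: (@has_cell_before T.-1); first by lia.
  have -> : T.-1 = T'.-1 + phase_start (size w) j by lia.
  by rewrite iterD.
split; [split|by rewrite actT inE|by rewrite actT inE; case: (odd j)].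
  by rewrite !actT !inE; case: (odd j).
move=> t /before tT; rewrite !xconf_go; split; apply: not_active_cell; auto.
Qed.

End Machine.

(** * Running time *)

Lemma shift_time_le l i j : shift_time l i j <= j * (2 * (l + i + j) + 1).
Proof.
elim: j i => //= j IHj i; have := IHj i.+1.
have -> : l + i.+1 + j = l + i + j.+1 by lia.
by rewrite (mulSn j); move: (j * _) (shift_time _ _ _) => k k'; lia.
Qed.

Lemma leq_sqr n : n <= n * n.
Proof. by case: n => // n; rewrite leq_pmulr. Qed.

Lemma fork_time_le l : fork_time l <= 10 * (l * l).
Proof.
rewrite /fork_time; have := shift_time_le l 0 l; have := leq_sqr l.
have -> : l * (2 * (l + 0 + l) + 1) = 4 * (l * l) + l by rewrite addn0; ring.
by move: (l * l) (shift_time _ _ _) => k k'; lia.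
Qed.

Lemma forks_time_le n j : forks_time n j <= j * (12 * (n * n)).
Proof.
elim: j => //= j IHj; have := fork_time_le n; have := leq_sqr n.
move: IHj; rewrite (mulSn j).
by move: (n * n) (fork_time _) (forks_time _ _) (j * _) => *; lia.
Qed.

Lemma step_time_le n : step_time n <= 10 * (n * n).
Proof.
rewrite /step_time; have := leq_sqr n.
have -> : 2 * n * n.+1 + (2 * n + 4 * n * n) = 6 * (n * n) + 4 * n by ring.
by move: (n * n) => *; lia.
Qed.

Lemma walk_time_le n pads : walk_time n pads <= 2 * n + size pads * (22 * (n * n)).
Proof.
elim: pads => [|b pads IHp] /=; first by rewrite addn0.
have := fork_time_le n; have := step_time_le n; have := leq_sqr n.
rewrite (mulSn (size pads)); move: IHp.
move: (n * n) (walk_time _ _) (fork_time _) (step_time _) (size pads * _) => *.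
by case: b; lia.
Qed.

Lemma phase_time_le n pads : size pads <= n -> phase_time n pads <= 40 * n ^ 3.
Proof.
move=> pn; rewrite /phase_time.
have -> : n ^ 3 = n * (n * n) by rewrite !expnS expn0; ring.
have P : size pads * (22 * (n * n)) <= 22 * (n * (n * n)).
  by rewrite [leqRHS]mulnCA leq_mul2r pn orbT.
have F : n * (12 * (n * n)) = 12 * (n * (n * n)) by rewrite mulnCA.
have N : n <= n * (n * n) by rewrite (leq_trans (leq_sqr n)) // leq_mul2l leq_sqr orbT.
have := forks_time_le n n; have := walk_time_le n pads; rewrite F; move: P N.
by move: (n * (n * n)) (size pads * _) (walk_time _ _) (forks_time _ _) => *; lia.
Qed.

Lemma phase_len_le n pads : size pads <= n -> 0 < n -> phase_len n pads <= 48 * n ^ 3.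
Proof.
move=> pn n0; rewrite /phase_len; have := phase_time_le pn.
have : n <= n ^ 3 by rewrite -{1}[n]expn1 leq_pexp2l.
by move: (n ^ 3) (phase_time _ _) => *; lia.
Qed.

Lemma phase_start_le n j : 0 < n -> phase_start n j <= 1 + j * (48 * (2 * j + n) ^ 3).
Proof.
(* [N] is fixed throughout the induction, so that the bound for the longest block serves for all
   earlier phases. *)
move=> n0; suff H N i : 2 * i + n <= N -> phase_start n i <= 1 + i * (48 * N ^ 3) by apply: H.
elim: i => // i IHi iN; rewrite [phase_start _ _]/= addnC.
have {}IHi : phase_start n i <= 1 + i * (48 * N ^ 3) by apply: IHi; lia.
have L : phase_len (2 * i + n) (pads_at i) <= 48 * N ^ 3.
  apply: leq_trans (phase_len_le _ _) _; [by rewrite size_pads_at; lia | by lia |].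
  by rewrite leq_mul2l leq_exp2r //; lia.
move: IHi L; rewrite (mulSn i).
by move: (48 * _) (phase_start _ _) (phase_len _ _) (i * _) => *; lia.
Qed.

Lemma halt_time_le n j : 0 < n -> halt_time n j <= 50 * (2 * j + n) ^ 4.
Proof.
move=> n0; rewrite /halt_time; set m := 2 * j + n; set v := wait _ _ _.
have v1 : v <= 1 by apply: wait_le1.
have := phase_start_le j n0; rewrite -/m => S.
have P : phase_time m (pads_at j) <= 40 * m ^ 3.
  by apply: phase_time_le; rewrite size_pads_at /m; lia.
have m1 : m <= m ^ 3 by rewrite -{1}[m]expn1 leq_pexp2l // /m; lia.
have m0 : 0 < m ^ 3 by rewrite expn_gt0 /m; apply/orP; left; lia.
have J : j.+1 * (48 * m ^ 3) <= 48 * m ^ 4.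
  by rewrite expnS mulnCA leq_mul2l /=; apply: leq_mul => //; rewrite /m; lia.
have M4 : m ^ 3 <= m ^ 4 by rewrite leq_pexp2l // /m; lia.
move: J; rewrite mulSn; move: S P m1 m0 M4.
by move: (m ^ 3) (m ^ 4) (phase_time _ _) (phase_start _ _) (j * _) => *; lia.
Qed.

(** The length [2 * j + n] is at most [4 * t + 2 + n], hence at most [(4 * c + 2) * n.+1 ^ k.+1];
    the fourth power is that of [halt_time_le]. *)
Lemma poly_bound c k n j t : 0 < n -> j <= 2 * t + 1 -> t <= c * n.+1 ^ k ->
  50 * (2 * j + n) ^ 4 <= 50 * (4 * c + 2) ^ 4 * n.+1 ^ (k.+1 * 4).
Proof.
move=> n0 jt tc; rewrite expnM -mulnA -expnMn leq_mul2l /= leq_exp2r //.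
have A : n.+1 ^ k <= n.+1 ^ k.+1 by rewrite leq_pexp2l.
have B : n.+1 <= n.+1 ^ k.+1 by rewrite -{1}[n.+1]expn1 leq_pexp2l.
have C : c * n.+1 ^ k <= c * n.+1 ^ k.+1 by rewrite leq_mul2l A orbT.
have -> : (4 * c + 2) * n.+1 ^ k.+1 = 4 * (c * n.+1 ^ k.+1) + 2 * n.+1 ^ k.+1 by ring.
move: A B C tc; by move: (n.+1 ^ k) (n.+1 ^ k.+1) (c * n.+1 ^ k) (c * n.+1 ^ k.+1) => *; lia.
Qed.

Theorem theorem5 (Sigma : finType) (L : pred (seq Sigma)) :
  MAR_XCAP L <-> XCAP L.
Proof.
split=> [[X [Qacc [Qrej [k [c dec]]]]]|[X [a [r [_ dec]]]]]; last by exists X, [set a], [set r].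
pose Y := Y Qacc Qrej.
exists Y, (Ya X : xQ Y), (Yr X : xQ Y); split=> //.
exists (k.+1 * 4), (50 * (4 * c + 2) ^ 4) => u /eqP u0.
have [t [[_ before] tc Lt]] := dec u (introN eqP u0).
have n0 : 0 < size u by case: (u) u0.
(* The first phase that succeeds: the accept phase for [t] if the input is in [L], and the reject
   phase for [t] otherwise. *)
pose j := 2 * t + ~~ L u.
have jE : (odd j = ~~ L u) * (j./2 = t).
  by rewrite /j oddD mul2n odd_double oddb addnC half_bit_double.
have good_j : query Qacc Qrej u j.
  by rewrite /query !jE; case: (L u) Lt => /andP[].
have bad i : i < j -> ~~ query Qacc Qrej u i.
  rewrite /query => ij; have := odd_double_half i; case: (ltngtP i./2 t) => [it|it|->] iE.
  - by have [] := before _ it; case: odd.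
  - by move: ij iE; rewrite /j; case: (L u); case: odd => /=; lia.
  (* Here [i] is the accept phase for the same [t] and the input is rejected; its test fails because
     [decides_poly] lets only one of the two conditions hold at time [t]. *)
  - have -> : odd i = false by move: ij iE; rewrite /j; case: (L u); case: odd => //=; lia.
    have nL : ~~ L u by move: ij iE; rewrite /j; case: (L u) => //=; lia.
    by move: Lt; rewrite (negPf nL) => /andP[].
have [H Ha Hr] := Y_halts u0 bad good_j.
exists (halt_time (size u) j); split=> //.
  apply: leq_trans (halt_time_le _ n0) _; apply: (poly_bound n0 _ tc).
  by rewrite /j leq_add2l leq_b1.
by move: Ha Hr; rewrite jE; case: (L u) => /= -> ->.
Qed.
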